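(* Let $G$ be an étale groupoid with unit space $G^{(0)}$, let $\mu$ be a Radon probability measure on $G^{(0)}$, and let $\phi_\mu$ be the state on the $C^*$-subalgebra $C_0(G^{(0)})\subset C^*_{\mathrm{red}}(G)$ given by $\phi_\mu(f)=\int_{G^{(0)}}f\,d\mu$. The following conditions are equivalent: (i) $\mu$ is totally balanced; (ii) $\phi_\mu$ is elementary invariant; (iii) $\phi_\mu$ is fully invariant; (iv) $\phi_\mu\circ\mathbb{E}_{\mathrm{red}}$ is a tracial state on $C^*_{\mathrm{red}}(G)$.
   Context: Étale groupoid: a groupoid $G$ with a Hausdorff, locally compact, second countable topology such that composition and inversion are continuous and the range and source maps $r(\gamma)=\gamma\gamma^{-1}$, $s(\gamma)=\gamma^{-1}\gamma$ from $G$ to the unit space $G^{(0)}$ are local homeomorphisms. A bisection is an open set $X\subset G$ such that $s|_X:X\to s(X)$ and $r|_X:X\to r(X)$ are homeomorphisms onto open sets. For subsets $P,Q\subset G$, $PQ$ is the set of all products $\alpha\beta$ of composable pairs with $\alpha\in P$, $\beta\in Q$, and $X^{-1}=\{\gamma^{-1}:\gamma\in X\}$. $C_c(G)$ is a $*$-algebra under $(f\times g)(\gamma)=\sum_{\alpha\beta=\gamma}f(\alpha)g(\beta)$ and $f^*(\gamma)=\overline{f(\gamma^{-1})}$; $C^*_{\mathrm{red}}(G)$ is the reduced groupoid $C^*$-algebra (a completion of $C_c(G)$), which contains $C_0(G^{(0)})$ as a non-degenerate $C^*$-subalgebra, and $\mathbb{E}_{\mathrm{red}}:C^*_{\mathrm{red}}(G)\to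 C_0(G^{(0)})$ is the natural conditional expectation, extending the restriction map $f\mapsto f|_{G^{(0)}}$ on $C_c(G)$. A measure $\mu$ on $G^{(0)}$ is $X$-balanced, for an open bisection $X$, if $\mu(XBX^{-1})=\mu(s(X)\cap B)$ for every Borel set $B\subset G^{(0)}$; it is totally balanced if it is $X$-balanced for every open bisection $X$. With $A=C^*_{\mathrm{red}}(G)$ and $B=C_0(G^{(0)})$, an element $n\in A$ is a normalizer of $B$ if $nBn^*\cup n^*Bn\subset B$. For a normalizer $n$, a state $\phi$ on $B$ is $n$-invariant if $\phi(nbn^* )=\phi(n^*nb)$ for all $b\in B$. The state $\phi$ is fully invariant if it is $n$-invariant for all normalizers $n$ of $B$ in $A$. Elementary normalizers are the functions in $C_c(X)\subset C_c(G)\subset A$ with $X$ a bisection (these are normalizers of $B$); $\phi$ is elementary invariant if it is $n$-invariant for every elementary normalizer $n$. A tracial state is a state $\tau$ with $\tau(xy)=\tau(yx)$ for all $x,y$. *)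

(* Defs.v *)
From HB Require Import structures.
From mathcomp Require Import all_boot all_order all_algebra.
From mathcomp Require Import all_classical all_reals all_analysis.
From mathcomp Require Import complex ring.

Set Implicit Arguments.
Unset Strict Implicit.
Unset Printing Implicit Defensive.

Import Order.TTheory GRing.Theory Num.Theory.
Import numFieldNormedType.Exports.

Local Open Scope classical_set_scope.
Local Open Scope complex_scope.
Local Open Scope ring_scope.

(* [R[i]] does not come with its norm topology: it is taken from the generic
   one on a [numClosedFieldType]. *)
HB.instance Definition _ (R : realType) :=
  PseudoPointedMetric.copy R[i] (R[i] : numClosedFieldType)^o.
HB.instance Definition _ (R : realType) :=
  NormedModule.copy R[i] (R[i] : numClosedFieldType)^o.

(* The norm `|z| lives in [R[i]]; this is the same number in [R]. *)
Definition cabs (R : realType) (z : R[i]) : R := complex.Re `|z|.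

Section Groupoids.

(* Groupoids in the sense of Hahn and Renault: a partial product, defined on
   the set [gcomp] of composable pairs, and an inversion. As usual, it follows
   that [gcomp (a, b)] holds if and only if [a^-1 a = b b^-1]. *)
Record groupoid (T : Type) := Groupoid {
  gcomp : set (T * T);
  gmul : T -> T -> T;
  ginv : T -> T;
  ginvK : involutive ginv;
  gcompV : forall a, gcomp (a, ginv a);
  gmulA : forall a b c, gcomp (a, b) -> gcomp (b, c) ->
    [/\ gcomp (gmul a b, c), gcomp (a, gmul b c)
      & gmul (gmul a b) c = gmul a (gmul b c)];
  gmulKl : forall a b, gcomp (a, b) -> gmul (ginv a) (gmul a b) = b;
  gmulKr : forall a b, gcomp (a, b) -> gmul (gmul a b) (ginv b) = a
}.

Variables (T : Type) (S : groupoid T).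

Definition gunits : set T := range (fun a => gmul S a (ginv S a)).

Lemma gunits_range (a : T) : gmul S a (ginv S a) \in gunits.
Proof. by apply/mem_set; exists a. Qed.

Lemma gunits_source (a : T) : gmul S (ginv S a) a \in gunits.
Proof. by rewrite -{2}(ginvK S a) gunits_range. Qed.

Definition grange (a : T) : set_type gunits :=
  exist (fun x => x \in gunits) _ (gunits_range a).

Definition gsource (a : T) : set_type gunits :=
  exist (fun x => x \in gunits) _ (gunits_source a).

Definition gsetmul (P Q : set T) : set T :=
  [set gmul S p.1 p.2 | p in gcomp S `&` (P `*` Q)].

Definition gsetinv (P : set T) : set T := ginv S @` P.

End Groupoids.

(* [f] restricts to a homeomorphism from [X] onto an open subset of [V]. *)
Definition homeo_onto_open (U V : topologicalType) (f : U -> V) (X : set U) :=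
  [/\ open (f @` X),
      {within X, continuous f}
    & exists g : V -> U,
        {within f @` X, continuous g} /\ (forall x, X x -> g (f x) = x)].

Definition local_homeo (U V : topologicalType) (f : U -> V) :=
  forall x, exists X, [/\ open X, X x & homeo_onto_open f X].

(* [set_type A] carries the subspace topology of [A]. *)
Record etale_groupoid := EtaleGroupoid {
  arrow :> ptopologicalType;
  gpd : groupoid arrow;
  _ : hausdorff_space arrow;
  _ : locally_compact [set: arrow];
  _ : @second_countable arrow;
  _ : {within gcomp gpd, continuous (fun p => gmul gpd p.1 p.2)};
  _ : continuous (ginv gpd);
  _ : local_homeo (grange gpd);
  _ : local_homeo (gsource gpd)
}.

Definition unit_space (G : etale_groupoid) : Type := set_type (gunits (gpd G)).

HB.instance Definition _ (G : etale_groupoid) :=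
  Topological.copy (unit_space G) (set_type (gunits (gpd G))).
HB.instance Definition _ (G : etale_groupoid) :=
  isPointed.Build (unit_space G) (gsource (gpd G) point).
HB.instance Definition _ (G : etale_groupoid) :=
  Measurable.copy (unit_space G) (g_sigma_algebraType (@open (unit_space G))).

Section EtaleGroupoids.
Variable G : etale_groupoid.

Definition rng (a : G) : unit_space G := grange (gpd G) a.
Definition src (a : G) : unit_space G := gsource (gpd G) a.

Definition bisection (X : set G) :=
  [/\ open X, homeo_onto_open src X & homeo_onto_open rng X].

Definition of_unit (u : unit_space G) : G :=
  set_val (u : set_type (gunits (gpd G))).

(* X B X^-1, for a set B of units *)
Definition gconj (X : set G) (B : set (unit_space G)) : set (unit_space G) :=
  of_unit @^-1` gsetmul (gpd G) (gsetmul (gpd G) X (of_unit @` B))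
                        (gsetinv (gpd G) X).

End EtaleGroupoids.

Section Measures.
Variables (R : realType) (G : etale_groupoid).
Variable mu : {measure set (unit_space G) -> \bar R}.

Definition balanced (X : set G) :=
  forall B : set (unit_space G), measurable B ->
    mu (gconj X B) = mu ((@src G @` X) `&` B).

Definition totally_balanced := forall X : set G, bisection X -> balanced X.

Definition radon :=
  (forall K : set (unit_space G), compact K -> (mu K < +oo)%E) /\
  (forall B : set (unit_space G), measurable B ->
    mu B = ereal_sup [set mu K | K in [set K | compact K /\ K `<=` B]]).

(* The functional f |-> \int f d mu, for complex-valued f. *)
Definition phi_of (f : unit_space G -> R[i]) : R[i] :=
  Rintegral mu setT (fun u => complex.Re (f u)) +i*
  Rintegral mu setT (fun u => complex.Im (f u)).

End Measures.

Section SquareSummable.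
Variables (R : realType) (I : choiceType).

Definition normsq (f : I -> R[i]) : \bar R :=
  \esum_(i in [set: I]) (cabs (f i) ^+ 2)%:E.

Definition square_summable : {pred I -> R[i]} :=
  fun f => `[< (normsq f < +oo)%E >].

Lemma normsq0 : normsq 0 = 0%E.
Proof. by apply: esum1 => i _; rewrite /cabs normr0 expr0n. Qed.

Lemma cabs_ge0 (z : R[i]) : 0 <= cabs z.
Proof. by rewrite /cabs; have := normr_ge0 z; rewrite lecE => /andP[]. Qed.

Lemma cabsE (z : R[i]) : `|z| = (cabs z)%:C.
Proof. by []. Qed.

Lemma cabsM (z w : R[i]) : cabs (z * w) = cabs z * cabs w.
Proof. by rewrite /cabs normrM !cabsE /= !mulr0 subr0. Qed.

Lemma le_cabsD (z w : R[i]) : cabs (z + w) <= cabs z + cabs w.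
Proof. by have := ler_normD z w; rewrite !cabsE lecE => /andP[]. Qed.

Lemma square_summableD (f g : I -> R[i]) :
  f \in square_summable -> g \in square_summable -> f + g \in square_summable.
Proof.
move=> /asboolP sf /asboolP sg; apply/asboolP.
pose a (h : I -> R[i]) i := (cabs (h i) ^+ 2)%:E.
have a0 h i : (0 <= a h i)%E by rewrite lee_fin sqr_ge0.
have aa0 h i : (0 <= a h i + a h i)%E by rewrite adde_ge0.
apply: (@le_lt_trans _ _
  (\esum_(i in [set: I]) ((a f i + a f i) + (a g i + a g i)))%E).
  apply: le_esum => i _; rewrite /a -!EFinD lee_fin.
  apply: (@le_trans _ _ ((cabs (f i) + cabs (g i)) ^+ 2)).
    by rewrite ler_sqr ?nnegrE ?addr_ge0 ?cabs_ge0// le_cabsD.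
  rewrite -subr_ge0.
  set x := cabs (f i); set y := cabs (g i).
  suff -> : x ^+ 2 + x ^+ 2 + (y ^+ 2 + y ^+ 2) - (x + y) ^+ 2 = (x - y) ^+ 2.
    exact: sqr_ge0.
  by rewrite sqrrD sqrrB; ring.
by rewrite !esumD//; do !apply: lte_add_pinfty.
Qed.

Lemma square_summableZ (c : R[i]) (f : I -> R[i]) :
  f \in square_summable -> c *: f \in square_summable.
Proof.
move=> /asboolP sf; apply/asboolP.
apply: (@le_lt_trans _ _ ((cabs c ^+ 2)%:E * normsq f)%E).
  apply: ge_ereal_sup => _ [X [finX _] <-].
  rewrite (eq_fsbigr (fun i => (cabs c ^+ 2)%:E * (cabs (f i) ^+ 2)%:E)%E).
    rewrite -ge0_mule_fsumr; last by move=> i; rewrite lee_fin sqr_ge0.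
    apply: lee_wpmul2l; first by rewrite lee_fin sqr_ge0.
    by apply: ereal_sup_ubound; exists X.
  by move=> i _; rewrite -EFinM -exprMn -cabsM.
by rewrite lte_mul_pinfty// lee_fin sqr_ge0.
Qed.

Lemma square_summable_submod : submod_closed square_summable.
Proof.
split; first by apply/asboolP; rewrite normsq0 ltry.
by move=> c f g sf sg; apply: square_summableD => //; exact: square_summableZ.
Qed.

HB.instance Definition _ :=
  GRing.isSubmodClosed.Build R[i] (I -> R[i]) square_summable
    square_summable_submod.

Record l2 := L2 { l2_fun :> I -> R[i]; l2P : l2_fun \in square_summable }.

HB.instance Definition _ := [isSub for l2_fun].
HB.instance Definition _ := [Choice of l2 by <:].
HB.instance Definition _ := [SubChoice_isSubLmodule of l2 by <:].

End SquareSummable.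

Section HilbertSpace.
Variables (R : realType) (I : choiceType).
Local Notation H := (l2 R I).

Definition l2norm (x : H) : R := Num.sqrt (fine (normsq x)).

(* Unordered sums, of absolutely summable families. *)
Definition rsum (f : I -> R) : R :=
  fine (\esum_(i in [set: I]) (Num.max (f i) 0)%:E) -
  fine (\esum_(i in [set: I]) (Num.max (- f i) 0)%:E).

Definition csum (f : I -> R[i]) : R[i] :=
  rsum (fun i => complex.Re (f i)) +i* rsum (fun i => complex.Im (f i)).

Definition l2dot (x y : H) : R[i] := csum (fun i => x i * (y i)^*%C).

Lemma delta_summable (j : I) :
  (fun i => (i == j)%:R : R[i]) \in @square_summable R I.
Proof.
apply/asboolP; rewrite /normsq.
rewrite (_ : (\esum_(i in _) _)%E = \esum_(i in [set j]) 1%:E).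
  by rewrite esum_set1 ?ltry// lee_fin.
rewrite [RHS]esum_mkcond; apply: eq_esum => i _; rewrite in_set1.
by case: eqVneq => _; rewrite /cabs ?normr1 ?normr0 /= ?expr1n ?expr0n.
Qed.

Definition delta (j : I) : H := L2 (delta_summable j).

Definition opnorm (T : H -> H) : \bar R :=
  ereal_sup [set (l2norm (T x))%:E | x in [set x | l2norm x <= 1]].

Definition bounded_op (T : H -> H) := linear T /\ (opnorm T < +oo)%E.

Definition adjoint_to (T S : H -> H) :=
  forall x y : H, l2dot (T x) y = l2dot x (S y).

(* The adjoint: it exists and is unique when [T] is a bounded operator. *)
Definition opstar (T : H -> H) : H -> H := xget (cst 0) [set S | adjoint_to T S].

Definition is_state (A : set (H -> H)) (tau : (H -> H) -> R[i]) :=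
  [/\ forall (c : R[i]) S T, A S -> A T ->
        tau (c *: S + T) = c * tau S + tau T,
      forall T, A T -> 0 <= tau (opstar T \o T)
    & ereal_sup [set (cabs (tau T))%:E |
                 T in [set T | A T /\ (opnorm T <= 1)%E]] = 1%E].

Definition is_tracial_state (A : set (H -> H)) (tau : (H -> H) -> R[i]) :=
  is_state A tau /\ forall S T, A S -> A T -> tau (S \o T) = tau (T \o S).

End HilbertSpace.

Section ReducedCstarAlgebra.
Variables (R : realType) (G : etale_groupoid).

Definition csupp (f : G -> R[i]) : set G := closure [set a | f a != 0].

Definition Cc (f : G -> R[i]) := continuous f /\ compact (csupp f).

Definition Cc_on (X : set G) (f : G -> R[i]) := Cc f /\ csupp f `<=` X.

Definition C0 (b : unit_space G -> R[i]) :=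
  continuous b /\
  forall e : R, 0 < e -> compact [set u | e <= cabs (b u)].

(* (f x g)(a); the sum has finitely many nonzero terms for [f] in [Cc]. *)
Definition conv (f g : G -> R[i]) (a : G) : R[i] :=
  \sum_(p \in [set p | gcomp (gpd G) p /\ gmul (gpd G) p.1 p.2 = a])
    f p.1 * g p.2.

(* The left regular representation, on the sum l2(G) of the spaces
   l2(src^-1(u)). For [f] in [Cc], and for the extension by zero of a bounded
   function on the unit space, [conv f x] is square summable for every
   square-summable [x], so that the default value 0 is not used. *)
Definition lreg (f : G -> R[i]) (x : l2 R G) : l2 R G :=
  insubd (0 : l2 R G) (conv f x).

(* C*_red(G): the completion of Cc(G) in the reduced norm [opnorm (lreg f)],
   realized as the norm closure of its image under [lreg]. *)
Definition Cred (T : l2 R G -> l2 R G) :=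
  bounded_op T /\
  forall e : R, 0 < e ->
    exists2 f, Cc f & (opnorm (T - lreg f)%R <= e%:E)%E.

Definition ext0 (b : unit_space G -> R[i]) (a : G) : R[i] :=
  oapp b 0 (insub a : option (set_type (gunits (gpd G)))).

(* The inclusion of C0(G^(0)) in C*_red(G), its image and its inverse. *)
Definition diag (b : unit_space G -> R[i]) : l2 R G -> l2 R G := lreg (ext0 b).

Definition Diag : set (l2 R G -> l2 R G) := [set diag b | b in C0].

Definition undiag (T : l2 R G -> l2 R G) : unit_space G -> R[i] :=
  xget (cst 0) [set b | C0 b /\ diag b = T].

(* The conditional expectation: E(T)(u) = <T delta_u, delta_u>. *)
Definition Ered (T : l2 R G -> l2 R G) (u : unit_space G) : R[i] :=
  T (delta R (of_unit u)) (of_unit u).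

(* [Ered] extends the restriction of functions from G to G^(0). *)
Lemma Ered_conv (T : l2 R G -> l2 R G) (f : G -> R[i]) (u : unit_space G) :
  (forall x : l2 R G, T x = conv f x :> (G -> R[i])) ->
  Ered T u = f (of_unit u).
Proof.
move=> Tf; rewrite /Ered Tf /conv.
have [uu uuu] : gcomp (gpd G) (of_unit u, of_unit u) /\
    gmul (gpd G) (of_unit u) (of_unit u) = of_unit u.
  have [a _] : gunits (gpd G) (of_unit u) by exact: set_valP.
  move=> <-.
  have aV := gcompV (gpd G) a.
  have Va : gcomp (gpd G) (ginv (gpd G) a, a).
    by have := gcompV (gpd G) (ginv (gpd G) a); rewrite ginvK.
  have [ua _ _] := gmulA aV Va.
  have [_ cu eu] := gmulA ua aV.
  split=> //; rewrite -eu; congr gmul.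
  by have := gmulKr aV; rewrite ginvK.
rewrite -(@fsbig_widen _ _ _ _ [set (of_unit u, of_unit u)]).
- by rewrite fsbig_set1 /= eqxx mulr1.
- by move=> _ -> /=.
move=> [b c] /= [[bc bcu] ne]; case: eqVneq => [cu|]; last by rewrite mulr0.
exfalso; apply: ne; rewrite cu; congr (_, _); move: bc bcu; rewrite cu => bc bcu.
by rewrite -(gmulKr bc) bcu -{1}uuu (gmulKr uu).
Qed.

Definition normalizer (n : l2 R G -> l2 R G) :=
  Cred n /\
  forall T, Diag T ->
    Diag (n \o T \o opstar n) /\ Diag (opstar n \o T \o n).

Section Invariance.
Variable phi : (unit_space G -> R[i]) -> R[i].

Definition invariant (n : l2 R G -> l2 R G) :=
  forall b, C0 b ->
    phi (undiag (n \o diag b \o opstar n)) =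
    phi (undiag (opstar n \o n \o diag b)).

Definition fully_invariant := forall n, normalizer n -> invariant n.

Definition elementary_invariant :=
  forall X f, bisection X -> Cc_on X f -> invariant (lreg f).

End Invariance.

End ReducedCstarAlgebra.

(* Main.v *)
From HB Require Import structures.
From mathcomp Require Import all_boot all_order all_algebra.
From mathcomp Require Import all_classical all_reals all_analysis.
From mathcomp Require Import measurable_realfun complex ring lra.
Require Import Defs.

(** The idea is to compare the two measures on G obtained by lifting mu along
    the source and along the range map, that is, the sums over the fibres of
    [src] and of [rng], integrated against mu.

    A function k supported in a bisection X induces two functions on units,
    u |-> k(c) with c the point of X of source u, respectively of range u. If mu
    is X-balanced, they have the same distribution: for A avoiding 0, the
    homeomorphism of s(X) onto r(X) that X defines carries the set where the
    first one takes values in A onto the same set for the second one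
    ([balanced_distribution]). They have the same integral,
    and for k(c) = f(c) g(c^-1) these integrals are those of E(f x g) and
    E(g x f) ([Ered_mull], [Ered_mulr]). A partition of unity writes every f in
    Cc(G) as a finite sum of functions supported in bisections ([Cc_ind]), so
    phi o E is a trace on Cc(G), and on its completion by norm continuity of E
    and phi ([Cred_trace]). Thus (i) implies (iv).

    If phi o E is a trace, its values on (n b) n^* and n^* (n b) agree. When n
    is a normalizer both products lie in C0(G^(0)), where E is the identity; for
    the second one, n^* n b is the limit of n^* e n b with e running through an
    approximate unit of C0(G^(0)) ([normalizer_square]). Thus (iv) implies
    (iii), and (iii) implies (ii) since functions supported in bisections are
    normalizers ([lreg_conj], [lreg_normalizer]).

    Under (ii), for h in Cc(X), the two functions that |h|^2 induces on units
    have the same integral ([elementary_transfer]). Taking for h bump functions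
    that are 1 on a compact part C of X and are supported close to it yields
    mu(r(C)) = mu(s(C)) ([elementary_compact_le]); inner regularity passes from
    compact sets to Borel sets ([regular_le]), which is (i). *)

Set Implicit Arguments.
Unset Strict Implicit.
Unset Printing Implicit Defensive.

Import Order.TTheory GRing.Theory Num.Theory.
Import numFieldNormedType.Exports.

Local Open Scope classical_set_scope.
Local Open Scope complex_scope.
Local Open Scope ring_scope.

(** * Complex modulus and unordered sums *)

Section ComplexModulus.
Variable R : realType.
Implicit Types z w : R[i].

Lemma sqr_cabs z : cabs z ^+ 2 = complex.Re z ^+ 2 + complex.Im z ^+ 2.
Proof.
by case: z => a b; rewrite /cabs normc_def /= sqr_sqrtr// addr_ge0// sqr_ge0.
Qed.

Lemma cabs0 : cabs (0 : R[i]) = 0.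
Proof. by rewrite /cabs normr0. Qed.

Lemma cabs_eq0 z : cabs z = 0 -> z = 0.
Proof. by move=> z0; apply/eqP; rewrite -normr_eq0 cabsE z0. Qed.

Lemma cabsN z : cabs (- z) = cabs z.
Proof. by rewrite /cabs normrN. Qed.

Lemma cabsB z w : cabs (z - w) = cabs (w - z).
Proof. by rewrite /cabs distrC. Qed.

Lemma cabs_conj z : cabs (z^*)%C = cabs z.
Proof. by case: z => a b; rewrite /cabs !normc_def /= sqrrN. Qed.

Lemma cabs_real (x : R) : cabs (x%:C) = `|x|.
Proof. by rewrite /cabs normc_def /= expr0n addr0 sqrtr_sqr. Qed.

Lemma le_Re_cabs z : `|complex.Re z| <= cabs z.
Proof.
rewrite -(@ler_sqr R) ?nnegrE ?cabs_ge0// sqr_cabs real_normK ?num_real//.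
by rewrite lerDl sqr_ge0.
Qed.

Lemma le_Im_cabs z : `|complex.Im z| <= cabs z.
Proof.
rewrite -(@ler_sqr R) ?nnegrE ?cabs_ge0// sqr_cabs real_normK ?num_real//.
by rewrite lerDr sqr_ge0.
Qed.

Lemma mul_conjC z : z * (z^*)%C = (cabs z ^+ 2)%:C.
Proof.
rewrite sqr_cabs; case: z => a b; apply/eqP; rewrite eq_complex /=.
by apply/andP; split; apply/eqP; ring.
Qed.

Lemma le_cabs_ReIm z : cabs z <= `|complex.Re z| + `|complex.Im z|.
Proof.
case: z => a b /=; have -> : (a +i* b)%C = a%:C + 'i * b%:C.
  by apply/eqP; rewrite eq_complex /= !(mul0r, mul1r, subr0, addr0, add0r)
    !eqxx.
apply: le_trans (le_cabsD _ _) _; rewrite cabsM !cabs_real lerD2l.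
by rewrite /cabs normc_def /= expr0n add0r expr1n sqrtr1 mul1r.
Qed.

Lemma Re_add z w : complex.Re (z + w) = complex.Re z + complex.Re w.
Proof. by case: z w => [a b] [c d]. Qed.

Lemma Im_add z w : complex.Im (z + w) = complex.Im z + complex.Im w.
Proof. by case: z w => [a b] [c d]. Qed.

End ComplexModulus.

Section UnorderedSums.
Variables (R : realType) (I : choiceType).
Implicit Types f g u v : I -> R.

Lemma esumZ (c : R) u : 0 <= c -> (forall i, 0 <= u i) ->
  (\esum_(i in [set: I]) (c * u i)%:E = c%:E * \esum_(i in [set: I])
    (u i)%:E)%E.
Proof.
have le c' u' : 0 <= c' -> (forall i, 0 <= u' i) ->
    (\esum_(i in [set: I]) (c' * u' i)%:E <=
     c'%:E * \esum_(i in [set: I]) (u' i)%:E)%E.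
  move=> c0 u0; apply: ge_ereal_sup => _ [X [finX _] <-].
  rewrite (eq_fsbigr (fun i => c'%:E * (u' i)%:E)%E); last first.
    by move=> i _; rewrite EFinM.
  rewrite -ge0_mule_fsumr; last by move=> i; rewrite lee_fin.
  apply: lee_wpmul2l; first by rewrite lee_fin.
  by apply: ereal_sup_ubound; exists X.
move=> c0 u0; apply/eqP; rewrite eq_le le//=.
move: c0; rewrite [(0 <= c)%R]le_eqVlt => /orP[/eqP <-|c0].
  by rewrite mul0e; apply: esum_ge0 => i _; rewrite mul0r.
have ci : 0 <= c^-1 by rewrite invr_ge0 ltW.
have := le c^-1 (fun i => c * u i) ci (fun i => mulr_ge0 (ltW c0) (u0 i)).
under eq_esum do rewrite mulKf ?gt_eqF//.
move=> /(lee_wpmul2l (_ : 0 <= c%:E)%E) ; rewrite lee_fin => /(_ (ltW c0)).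
by rewrite muleA -EFinM divff ?gt_eqF// mul1e.
Qed.

Definition abs_summable f := (\esum_(i in [set: I]) `|f i|%:E < +oo)%E.

Lemma abs_summable_le f g : (forall i, `|f i| <= `|g i|) ->
  abs_summable g -> abs_summable f.
Proof.
by move=> fg; apply: le_lt_trans; apply: le_esum => i _; rewrite lee_fin.
Qed.

Lemma abs_summableD f g :
  abs_summable f -> abs_summable g -> abs_summable (fun i => f i + g i).
Proof.
move=> sf sg; apply: le_lt_trans (lte_add_pinfty sf sg); rewrite -esumD//.
by apply: le_esum => i _; rewrite -EFinD lee_fin ler_normD.
Qed.

Lemma abs_summableZ (c : R) f :
  abs_summable f -> abs_summable (fun i => c * f i).
Proof.
move=> sf; rewrite /abs_summable; under eq_esum do rewrite normrM.
by rewrite esumZ// lte_mul_pinfty// lee_fin.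
Qed.

Lemma fine_esumD u v : (forall i, 0 <= u i) -> (forall i, 0 <= v i) ->
  abs_summable u -> abs_summable v ->
  fine (\esum_(i in [set: I]) (u i + v i)%:E) =
  fine (\esum_(i in [set: I]) (u i)%:E) + fine (\esum_(i in [set: I]) (v i)%:E).
Proof.
move=> u0 v0 su sv; under eq_esum do rewrite EFinD.
rewrite esumD//; try by move=> i _; rewrite lee_fin.
have fin w : (forall i, 0 <= w i) -> abs_summable w ->
    (\esum_(i in [set: I]) (w i)%:E)%E \is a fin_num.
  move=> w0; rewrite /abs_summable ge0_fin_numE.
    by under eq_esum do rewrite ger0_norm//.
  by apply: esum_ge0 => i _; rewrite lee_fin.
by rewrite fineD ?fin.
Qed.

Let pos f : I -> R := fun i => Num.max (f i) 0.

Let pos_ge0 f i : 0 <= pos f i.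
Proof. by rewrite /pos le_max lexx orbT. Qed.

Let abs_summable_pos f : abs_summable f -> abs_summable (pos f).
Proof.
apply: abs_summable_le => i; rewrite ger0_norm// /pos ge_max normr_ge0 andbT.
exact: ler_norm.
Qed.

Let abs_summableN f : abs_summable f -> abs_summable (fun i => - f i).
Proof. by apply: abs_summable_le => i; rewrite normrN. Qed.

Let pos_sub f i : f i = pos f i - pos (fun i => - f i) i.
Proof. by rewrite /pos /Num.max; do 2 case: ltP => ?; lra. Qed.

(** Any decomposition of a family into a difference of summable nonnegative
    families computes its sum, so that no discussion of signs is needed in the
    proofs of linearity. *)
Lemma rsum_sub f u v : (forall i, 0 <= u i) -> (forall i, 0 <= v i) ->
  abs_summable u -> abs_summable v -> (forall i, f i = u i - v i) ->
  rsum f =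
  fine (\esum_(i in [set: I]) (u i)%:E) - fine (\esum_(i in [set: I]) (v i)%:E).
Proof.
move=> u0 v0 su sv fuv.
have sf : abs_summable f.
  have -> : f = (fun i => u i + - v i) by apply/funext.
  by apply: abs_summableD => //; exact: abs_summableN.
have := @fine_esumD (pos f) v (pos_ge0 f) v0 (abs_summable_pos sf) sv.
have := @fine_esumD u (pos (fun i => - f i)) u0 (pos_ge0 _) su
  (abs_summable_pos (abs_summableN sf)).
rewrite /rsum -/(pos f) -/(pos (fun i => - f i)).
have -> : (fun i => (pos f i + v i)%:E) =
          (fun i => (u i + pos (fun i => - f i) i)%:E).
  by apply/funext => i; congr EFin; have := pos_sub f i; rewrite fuv; lra.
by rewrite /pos /=; lra.
Qed.

Lemma rsumD f g : abs_summable f -> abs_summable g ->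
  rsum (fun i => f i + g i) = rsum f + rsum g.
Proof.
move=> sf sg; have sf' := abs_summableN sf; have sg' := abs_summableN sg.
rewrite (@rsum_sub _ (fun i => pos f i + pos g i)
  (fun i => pos (fun i => - f i) i + pos (fun i => - g i) i)).
- rewrite (fine_esumD (pos_ge0 f) (pos_ge0 g)); try exact: abs_summable_pos.
  rewrite (fine_esumD (pos_ge0 (fun i => - f i)) (pos_ge0 (fun i => - g i)));
    try exact: abs_summable_pos.
  by rewrite /rsum opprD addrACA.
- by move=> i; rewrite addr_ge0.
- by move=> i; rewrite addr_ge0.
- by apply: abs_summableD; exact: abs_summable_pos.
- by apply: abs_summableD; exact: abs_summable_pos.
- by move=> i; rewrite {1}(pos_sub f) {1}(pos_sub g); lra.
Qed.

Lemma rsumN f : rsum (fun i => - f i) = - rsum f.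
Proof.
by rewrite /rsum opprB; congr (_ - _); congr fine; apply: eq_esum => i _;
  rewrite opprK.
Qed.

Lemma rsumZ (c : R) f : abs_summable f -> rsum (fun i => c * f i) = c * rsum f.
Proof.
have pZ c' f' : 0 <= c' -> abs_summable f' ->
    rsum (fun i => c' * f' i) = c' * rsum f'.
  move=> c0 sf; rewrite (@rsum_sub _ (fun i => c' * pos f' i)
    (fun i => c' * pos (fun i => - f' i) i)).
  - have Z u : (forall i, 0 <= u i) -> abs_summable u ->
        fine (\esum_(i in [set: I]) (c' * u i)%:E) =
        c' * fine (\esum_(i in [set: I]) (u i)%:E).
      move=> u0 su; rewrite esumZ// fineM// ge0_fin_numE.
        by move: su; rewrite /abs_summable;
          under eq_esum do rewrite ger0_norm//.
      by apply: esum_ge0 => i _; rewrite lee_fin.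
    have sf' := abs_summableN sf.
    rewrite (Z _ (pos_ge0 _) (abs_summable_pos sf)).
    by rewrite (Z _ (pos_ge0 _) (abs_summable_pos sf')) -mulrBr.
  - by move=> i; rewrite mulr_ge0.
  - by move=> i; rewrite mulr_ge0.
  - exact/abs_summableZ/abs_summable_pos.
  - exact/abs_summableZ/abs_summable_pos/abs_summableN.
  - by move=> i; rewrite {1}(pos_sub f'); lra.
move=> sf; have [c0|c0] := leP 0 c; first exact: pZ.
have := pZ (- c) (fun i => - f i); rewrite oppr_ge0 ltW// => /(_ isT).
move=> /(_ (abs_summableN sf)); rewrite rsumN mulrNN => <-.
by congr rsum; apply/funext => i; rewrite mulrNN.
Qed.

Lemma rsum_ge0E u : (forall i, 0 <= u i) ->
  rsum u = fine (\esum_(i in [set: I]) (u i)%:E).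
Proof.
move=> u0; rewrite /rsum [X in _ - fine X]esum1 ?subr0.
  by congr fine; apply: eq_esum => i _; rewrite max_l.
by move=> i _; rewrite max_r// oppr_le0.
Qed.

Lemma rsum_le f (M : R) :
  (\esum_(i in [set: I]) `|f i|%:E <= M%:E)%E -> rsum f <= M.
Proof.
move=> fM; rewrite /rsum lerBlDr.
apply: (@le_trans _ _ M); last first.
  by rewrite lerDl fine_ge0//; apply: esum_ge0 => i _;
    rewrite lee_fin le_max lexx orbT.
rewrite -[M]/(fine M%:E) fine_le//.
  rewrite ge0_fin_numE; last first.
    by apply: esum_ge0 => i _; rewrite lee_fin le_max lexx orbT.
  apply: le_lt_trans (ltry M); apply: le_trans fM.
  by apply: le_esum => i _; rewrite lee_fin ge_max ler_norm normr_ge0.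
apply: le_trans fM.
by apply: le_esum => i _; rewrite lee_fin ge_max ler_norm normr_ge0.
Qed.

Definition cabs_summable (f : I -> R[i]) := abs_summable (fun i => cabs (f i)).

Lemma abs_summable_Re (f : I -> R[i]) : cabs_summable f ->
  abs_summable (fun i => complex.Re (f i)).
Proof.
by apply: abs_summable_le => i; rewrite (ger0_norm (cabs_ge0 _)) le_Re_cabs.
Qed.

Lemma abs_summable_Im (f : I -> R[i]) : cabs_summable f ->
  abs_summable (fun i => complex.Im (f i)).
Proof.
by apply: abs_summable_le => i; rewrite (ger0_norm (cabs_ge0 _)) le_Im_cabs.
Qed.

Lemma csumD (f g : I -> R[i]) : cabs_summable f -> cabs_summable g ->
  csum (fun i => f i + g i) = csum f + csum g.
Proof.
move=> sf sg; apply/eqP; rewrite eq_complex /=.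
have -> : (fun i => complex.Re (f i + g i)) =
    (fun i => complex.Re (f i) + complex.Re (g i)).
  by apply/funext => i; rewrite Re_add.
have -> : (fun i => complex.Im (f i + g i)) =
    (fun i => complex.Im (f i) + complex.Im (g i)).
  by apply/funext => i; rewrite Im_add.
rewrite (rsumD (abs_summable_Re sf) (abs_summable_Re sg)).
by rewrite (rsumD (abs_summable_Im sf) (abs_summable_Im sg)) !eqxx.
Qed.

Lemma csumZ (c : R[i]) (f : I -> R[i]) : cabs_summable f ->
  csum (fun i => c * f i) = c * csum f.
Proof.
move=> sf; have sr := abs_summable_Re sf; have si := abs_summable_Im sf.
case: c => a b; apply/eqP; rewrite eq_complex /=.
have -> : (fun i => complex.Re ((a +i* b)%C * f i)) =
    (fun i => a * complex.Re (f i) + (- b) * complex.Im (f i)).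
  by apply/funext => i; case: (f i) => x y /=; rewrite mulNr.
have -> : (fun i => complex.Im ((a +i* b)%C * f i)) =
    (fun i => a * complex.Im (f i) + b * complex.Re (f i)).
  by apply/funext => i; case: (f i) => x y /=.
rewrite !rsumD; try exact: abs_summableZ.
by rewrite !rsumZ// mulNr !eqxx.
Qed.

Lemma csum_conj (f : I -> R[i]) : csum (fun i => (f i)^*%C) = (csum f)^*%C.
Proof.
apply/eqP; rewrite eq_complex /= -rsumN.
by apply/andP; split; apply/eqP; congr rsum; apply/funext => i; case: (f i).
Qed.

Lemma csum_one (j : I) (f : I -> R[i]) : (forall i, i != j -> f i = 0) ->
  csum f = f j.
Proof.
move=> f0.
have one (u : I -> R) : (forall i, i != j -> u i = 0) -> rsum u = u j.
  move=> u0; have E (w : I -> R) : (forall i, 0 <= w i) -> (forall i, i != j ->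
    w i = 0) ->
      (\esum_(i in [set: I]) (w i)%:E)%E = (w j)%:E.
    move=> wp w0; rewrite -(@esum_set1 _ _ j (fun i => (w i)%:E)) ?lee_fin//.
    rewrite [RHS]esum_mkcond; apply: eq_esum => i _; rewrite in_set1.
    by case: eqVneq => // /w0 ->.
  rewrite /rsum !E /=; first exact/esym/pos_sub.
  - by move=> i; rewrite le_max lexx orbT.
  - by move=> i /u0 ->; rewrite oppr0 maxxx.
  - by move=> i; rewrite le_max lexx orbT.
  - by move=> i /u0 ->; rewrite maxxx.
by rewrite /csum !one; [case: (f j) | move=> i /f0 -> | move=> i /f0 ->].
Qed.

End UnorderedSums.

Section Reindex.
Variables (R : realType) (I J : choiceType).
Variables (D : set I) (D' : set J) (e : I -> J) (De : set_bij D D' e).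

Lemma esum_reindex (u : I -> \bar R) (v : J -> \bar R) :
  (forall i, D i -> u i = v (e i)) ->
  (forall i, ~ D i -> u i = 0%E) -> (forall j, ~ D' j -> v j = 0%E) ->
  (\esum_(i in [set: I]) u i = \esum_(j in [set: J]) v j)%E.
Proof.
move=> uv u0 v0.
transitivity (\esum_(i in D) u i)%E.
  rewrite [RHS]esum_mkcond; apply: eq_esum => i _.
  by case: ifPn => // /negP; rewrite inE => /u0.
transitivity (\esum_(j in D') v j)%E; last first.
  rewrite [LHS]esum_mkcond; apply: eq_esum => i _.
  by case: ifPn => // /negP; rewrite inE => /v0 ->.
by rewrite (reindex_esum D D' e)//; exact: eq_esum.
Qed.

Lemma csum_reindex (f : I -> R[i]) (g : J -> R[i]) :
  (forall i, D i -> f i = g (e i)) ->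
  (forall i, ~ D i -> f i = 0) -> (forall j, ~ D' j -> g j = 0) ->
  csum f = csum g.
Proof.
move=> fg f0 g0; rewrite /csum /rsum.
have E (h : R[i] -> R) : h 0 = 0 ->
    (\esum_(i in [set: I]) (h (f i))%:E =
     \esum_(j in [set: J]) (h (g j))%:E)%E.
  move=> h0; apply: esum_reindex => [i /fg ->//|i /f0 ->|j /g0 ->];
    by rewrite h0.
rewrite (E (fun z => Num.max (complex.Re z) 0)) ?maxxx//.
rewrite (E (fun z => Num.max (- complex.Re z) 0)) ?oppr0 ?maxxx//.
rewrite (E (fun z => Num.max (complex.Im z) 0)) ?maxxx//.
by rewrite (E (fun z => Num.max (- complex.Im z) 0)) ?oppr0 ?maxxx.
Qed.

End Reindex.

(** * Square summable families and their operators *)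

Section HilbertSpace.
Variables (R : realType) (I : choiceType).
Local Notation H := (l2 R I).
Implicit Types x y z : H.

Lemma l2_inj x y : (forall i, x i = y i) -> x = y.
Proof. by move=> xy; apply: val_inj; apply/funext. Qed.

Lemma l2D x y i : (x + y) i = x i + y i.
Proof. by []. Qed.

Lemma l2Z (c : R[i]) x i : (c *: x) i = c * x i.
Proof. by []. Qed.

Lemma l20 i : (0 : H) i = 0.
Proof. by []. Qed.

Lemma normsq_ge0 (f : I -> R[i]) : (0 <= normsq f)%E.
Proof. by apply: esum_ge0 => i _; rewrite lee_fin sqr_ge0. Qed.

Lemma l2norm_ge0 x : 0 <= l2norm x.
Proof. exact: sqrtr_ge0. Qed.

Lemma normsqE x : normsq x = (l2norm x ^+ 2)%:E.
Proof.
rewrite /l2norm sqr_sqrtr ?fine_ge0 ?normsq_ge0// fineK//.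
by rewrite ge0_fin_numE ?normsq_ge0//; have /asboolP := l2P x.
Qed.

Lemma l2norm_le x (M : R) : 0 <= M ->
  (normsq x <= (M ^+ 2)%:E)%E -> l2norm x <= M.
Proof.
by move=> M0; rewrite normsqE lee_fin ler_sqr// ?nnegrE ?l2norm_ge0.
Qed.

Lemma le_esum1 (u : I -> \bar R) i : (forall j, 0 <= u j)%E ->
  (u i <= \esum_(j in [set: I]) u j)%E.
Proof.
move=> u0; rewrite -(@esum_set1 _ _ i u)// esum_mkcond.
by apply: le_esum => j _; case: ifP.
Qed.

Lemma le_cabs_l2norm x i : cabs (x i) <= l2norm x.
Proof.
rewrite -(@ler_sqr R) ?nnegrE ?cabs_ge0 ?l2norm_ge0// -lee_fin -normsqE.
by apply: (@le_esum1 (fun j => (cabs (x j) ^+ 2)%:E)) => j;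
  rewrite lee_fin sqr_ge0.
Qed.

Lemma l2norm_eq0 x : l2norm x = 0 -> x = 0.
Proof.
move=> x0; apply: l2_inj => i; apply: cabs_eq0; apply/eqP.
by rewrite eq_le cabs_ge0 andbT -x0 le_cabs_l2norm.
Qed.

Lemma l2norm0 : l2norm (0 : H) = 0.
Proof. by rewrite /l2norm normsq0 /= sqrtr0. Qed.

Lemma deltaE (j i : I) : delta R j i = (i == j)%:R.
Proof. by []. Qed.

Lemma l2norm_delta (j : I) : l2norm (delta R j) = 1.
Proof.
rewrite /l2norm /normsq (_ : (\esum_(i in _) _)%E = \esum_(i in [set j]) 1%:E).
  by rewrite esum_set1 ?sqrtr1// lee_fin.
rewrite [RHS]esum_mkcond; apply: eq_esum => i _; rewrite in_set1 deltaE.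
by case: eqVneq => _; rewrite /cabs ?normr1 ?normr0 /= ?expr1n ?expr0n.
Qed.

Lemma l2normZ (c : R[i]) x : l2norm (c *: x) = cabs c * l2norm x.
Proof.
apply/eqP; rewrite -(@eqrXn2 _ 2) ?l2norm_ge0 ?mulr_ge0 ?cabs_ge0 ?l2norm_ge0//.
rewrite exprMn -eqe -normsqE EFinM -normsqE /normsq.
under eq_esum do rewrite l2Z cabsM exprMn.
by rewrite esumZ ?sqr_ge0// => i; rewrite sqr_ge0.
Qed.

Lemma l2normN x : l2norm (- x) = l2norm x.
Proof. by rewrite -scaleN1r l2normZ cabsN /cabs normr1 mul1r. Qed.

(** The arithmetic-geometric inequality, balanced by the factor t = |y| / |x|,
    bounds the sum term by term. *)
Lemma cauchy_schwarz x y :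
  (\esum_(i in [set: I]) (cabs (x i) * cabs (y i))%:E <=
   (l2norm x * l2norm y)%:E)%E.
Proof.
have zero (u v : H) : l2norm u = 0 ->
    (\esum_(i in [set: I]) (cabs (u i) * cabs (v i))%:E <=
     (l2norm u * l2norm v)%:E)%E.
  move=> u0; rewrite u0 mul0r esum1// => i _.
  by rewrite (l2norm_eq0 u0) l20 cabs0 mul0r.
have [/zero //|x0] := eqVneq (l2norm x) 0.
have [y0|y0] := eqVneq (l2norm y) 0.
  by under eq_esum do rewrite mulrC; rewrite mulrC; exact: zero.
have {}x0 : 0 < l2norm x by rewrite lt_neqAle eq_sym x0 l2norm_ge0.
have {}y0 : 0 < l2norm y by rewrite lt_neqAle eq_sym y0 l2norm_ge0.
set a := l2norm x in x0 *; set b := l2norm y in y0 *.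
pose u i := (b / a / 2) * cabs (x i) ^+ 2.
pose v i := (a / b / 2) * cabs (y i) ^+ 2.
have u0 i : 0 <= u i by rewrite mulr_ge0 ?sqr_ge0// !divr_ge0// ltW.
have v0 i : 0 <= v i by rewrite mulr_ge0 ?sqr_ge0// !divr_ge0// ltW.
apply: (@le_trans _ _ (\esum_(i in [set: I]) ((u i)%:E + (v i)%:E))%E).
  apply: le_esum => i _; rewrite -EFinD lee_fin -subr_ge0.
  suff -> : u i + v i - cabs (x i) * cabs (y i) =
      (b * cabs (x i) - a * cabs (y i)) ^+ 2 / (2 * a * b).
    by rewrite divr_ge0 ?sqr_ge0// !mulr_ge0// ltW.
  by rewrite /u /v; field; rewrite !gt_eqF.
rewrite esumD; try by move=> i _; rewrite lee_fin.
have c0 (p q : R) : 0 < p -> 0 < q -> 0 <= p / q / 2.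
  by move=> *; rewrite !divr_ge0// ltW.
rewrite !esumZ ?c0//; try by move=> i; rewrite sqr_ge0.
rewrite -[X in (_ * X + _)%E]/(normsq x) -[X in (_ + _ * X)%E]/(normsq y).
rewrite !normsqE -!EFinM -EFinD lee_fin -/a -/b.
suff -> : b / a / 2 * a ^+ 2 + a / b / 2 * b ^+ 2 = a * b by [].
by field; rewrite !gt_eqF.
Qed.

Lemma l2normD x y : l2norm (x + y) <= l2norm x + l2norm y.
Proof.
apply: l2norm_le; first by rewrite addr_ge0 ?l2norm_ge0.
pose w i := cabs (x i) * cabs (y i).
apply: (@le_trans _ _ (\esum_(i in [set: I])
    ((cabs (x i) ^+ 2)%:E + (cabs (y i) ^+ 2)%:E + (2 * w i)%:E))%E).
  apply: le_esum => i _; rewrite -!EFinD lee_fin.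
  have -> : cabs (x i) ^+ 2 + cabs (y i) ^+ 2 + 2 * w i =
      (cabs (x i) + cabs (y i)) ^+ 2 by rewrite /w; ring.
  by rewrite ler_sqr ?nnegrE ?addr_ge0 ?cabs_ge0// l2D le_cabsD.
have w0 i : 0 <= w i by rewrite mulr_ge0 ?cabs_ge0.
rewrite esumD; last 2 first.
- by move=> i _; rewrite -EFinD lee_fin addr_ge0 ?sqr_ge0.
- by move=> i _; rewrite lee_fin mulr_ge0.
rewrite esumD; try by move=> i _; rewrite lee_fin sqr_ge0.
rewrite esumZ//.
rewrite -[X in (X + _ + _)%E]/(normsq x) -[X in (_ + X + _)%E]/(normsq y).
rewrite !normsqE -EFinD.
apply: (@le_trans _ _ ((l2norm x ^+ 2 + l2norm y ^+ 2)%:E +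
   2%:E * (l2norm x * l2norm y)%:E)%E).
  by rewrite leeD2l// lee_wpmul2l// ?lee_fin//; exact: cauchy_schwarz.
by rewrite -EFinM -EFinD lee_fin le_eqVlt; apply/orP; left; apply/eqP; ring.
Qed.

Lemma summable_dot x y : cabs_summable (fun i => x i * (y i)^*%C).
Proof.
apply: le_lt_trans (ltry (l2norm x * l2norm y)).
apply: le_trans (cauchy_schwarz x y); apply: le_esum => i _.
by rewrite ger0_norm ?cabs_ge0// cabsM cabs_conj.
Qed.

Lemma l2dotDl x y z : l2dot (x + y) z = l2dot x z + l2dot y z.
Proof.
rewrite /l2dot -csumD; try exact: summable_dot.
by congr csum; apply/funext => i; rewrite l2D mulrDl.
Qed.

Lemma l2dotC x y : l2dot y x = (l2dot x y)^*%C.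
Proof.
rewrite /l2dot -csum_conj; congr csum; apply/funext => i.
by rewrite rmorphM /= conjcK mulrC.
Qed.

Lemma l2dotDr x y z : l2dot z (x + y) = l2dot z x + l2dot z y.
Proof. by rewrite l2dotC l2dotDl rmorphD /= [l2dot z x]l2dotC [l2dot z
  y]l2dotC. Qed.

Lemma l2dotZl (c : R[i]) x y : l2dot (c *: x) y = c * l2dot x y.
Proof.
rewrite /l2dot -csumZ; last exact: summable_dot.
by congr csum; apply/funext => i; rewrite l2Z mulrA.
Qed.

Lemma l2dotZr (c : R[i]) x y : l2dot x (c *: y) = c^*%C * l2dot x y.
Proof. by rewrite l2dotC l2dotZl rmorphM /= [l2dot x y]l2dotC. Qed.

Lemma l2dotxx x : l2dot x x = (l2norm x ^+ 2)%:C.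
Proof.
rewrite /l2dot; under eq_fun do rewrite mul_conjC.
rewrite /csum /= rsum_ge0E; last by move=> i; rewrite sqr_ge0.
rewrite -[X in fine X]/(normsq x) normsqE /= rsum_ge0E//.
by rewrite esum1.
Qed.

Lemma Re_l2dot_le x y : complex.Re (l2dot x y) <= l2norm x * l2norm y.
Proof.
apply: rsum_le; apply: le_trans (cauchy_schwarz x y).
apply: le_esum => i _; rewrite lee_fin.
by apply: le_trans (le_Re_cabs _) _; rewrite cabsM cabs_conj.
Qed.

Lemma l2dot_deltar x j : l2dot x (delta R j) = x j.
Proof.
rewrite /l2dot (csum_one (j := j)); first by rewrite deltaE eqxx conjc1 mulr1.
by move=> i /negPf ij; rewrite deltaE ij conjc0 mulr0.
Qed.

Lemma l2dot_deltal x j : l2dot (delta R j) x = (x j)^*%C.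
Proof. by rewrite l2dotC l2dot_deltar. Qed.

(** For a linear map, a real upper bound of [opnorm] ([opnorm_opbound],
    [opbound_opnorm]); it avoids extended real numbers. *)
Definition opbound (T : H -> H) (M : R) :=
  forall x, l2norm (T x) <= M * l2norm x.

Implicit Types T S : H -> H.

Lemma opbound_opnorm T M : 0 <= M -> opbound T M -> (opnorm T <= M%:E)%E.
Proof.
move=> M0 TM; apply: ge_ereal_sup => _ [x /= x1 <-]; rewrite lee_fin.
by apply: le_trans (TM x) _; rewrite ler_piMr.
Qed.

Lemma linear_fun0 T : linear T -> T 0 = 0.
Proof.
by move=> /(_ 1 0 0); rewrite !scale1r addr0 -{1}[T 0]addr0 => /addrI/esym.
Qed.

Lemma linear_funZ T c x : linear T -> T (c *: x) = c *: T x.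
Proof. by move=> lT; have := lT c x 0;
  rewrite !addr0 (linear_fun0 lT) addr0. Qed.

Lemma linear_funD T x y : linear T -> T (x + y) = T x + T y.
Proof. by move=> lT; have := lT 1 x y; rewrite !scale1r. Qed.

Lemma linear_funB T x y : linear T -> T (x - y) = T x - T y.
Proof. by move=> lT; rewrite linear_funD// -scaleN1r linear_funZ// scaleN1r.
  Qed.

Lemma opnorm_opbound T M : linear T -> (opnorm T <= M%:E)%E -> opbound T M.
Proof.
move=> lT TM x; have [x0|x0] := eqVneq (l2norm x) 0.
  by rewrite (l2norm_eq0 x0) (linear_fun0 lT) l2norm0 mulr0.
have xp : 0 < l2norm x by rewrite lt_neqAle eq_sym x0 l2norm_ge0.
have inv_ge0 : 0 <= (l2norm x)^-1 by rewrite invr_ge0 ltW.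
have := @ereal_sup_ubound _ [set (l2norm (T x))%:E | x in [set x | l2norm x <=
  1]]
  (l2norm (T ((l2norm x)^-1%:C *: x)))%:E.
move=> /(_ _)/wrap[|/le_trans/(_ TM)].
  by exists ((l2norm x)^-1%:C *: x) => //=;
    rewrite l2normZ cabs_real ger0_norm// mulVf.
rewrite lee_fin linear_funZ// l2normZ cabs_real ger0_norm//.
by rewrite mulrC ler_pdivrMr.
Qed.

Lemma opbound_le T M M' : M <= M' -> opbound T M -> opbound T M'.
Proof.
by move=> MM' TM x; apply: le_trans (TM x) _; rewrite ler_wpM2r ?l2norm_ge0.
Qed.

Lemma bounded_opP T : bounded_op T <->
  linear T /\ exists2 M, 0 <= M & opbound T M.
Proof.
split=> [[lT nT]|[lT [M M0 TM]]]; split=> //; last first.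
  exact: le_lt_trans (opbound_opnorm M0 TM) (ltry _).
have n0 : (0 <= opnorm T)%E.
  apply: ereal_sup_ubound; exists 0; first by rewrite /= l2norm0 ler01.
  by rewrite (linear_fun0 lT) l2norm0.
exists (fine (opnorm T)); first by rewrite fine_ge0.
by apply: opnorm_opbound => //; rewrite fineK// ge0_fin_numE.
Qed.

Lemma linear_sub T S : linear T -> linear S -> linear (T - S).
Proof.
move=> lT lS c x y; rewrite !fctE lT lS opprD addrACA -scalerN -scalerDr.
by [].
Qed.

Lemma linear_comp T S : linear T -> linear S -> linear (T \o S).
Proof. by move=> lT lS c x y /=; rewrite lS lT. Qed.

Lemma opbound_comp T S M N : 0 <= M ->
  opbound T M -> opbound S N -> opbound (T \o S) (M * N).
Proof.
move=> M0 TM SN x /=; apply: le_trans (TM _) _; rewrite -mulrA.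
by rewrite ler_wpM2l.
Qed.

(** Testing against the basis determines an adjoint, whence its uniqueness and
    its linearity. *)
Lemma adjoint_coord T S : adjoint_to T S ->
  forall y i, S y i = (l2dot (T (delta R i)) y)^*%C.
Proof. by move=> TS y i; rewrite TS l2dot_deltal conjcK. Qed.

Lemma adjoint_uniq T S S' : adjoint_to T S -> adjoint_to T S' -> S = S'.
Proof.
move=> TS TS'; apply/funext => y; apply: l2_inj => i.
by rewrite (adjoint_coord TS) (adjoint_coord TS').
Qed.

Lemma opstarE T S : adjoint_to T S -> opstar T = S.
Proof.
move=> TS; rewrite /opstar; case: xgetP => [S' _ TS'|/(_ S)//].
exact: adjoint_uniq TS' TS.
Qed.

Lemma adjoint_linear T S : adjoint_to T S -> linear S.
Proof.
move=> TS c x y; apply: l2_inj => i; rewrite l2D l2Z !(adjoint_coord TS).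
by rewrite l2dotDr l2dotZr rmorphD rmorphM /= conjcK.
Qed.

Lemma adjoint_sub T S T' S' :
  adjoint_to T S -> adjoint_to T' S' -> adjoint_to (T - T') (S - S').
Proof.
move=> TS TS' x y; rewrite !fctE -scaleN1r -[in RHS]scaleN1r.
by rewrite l2dotDl l2dotDr l2dotZl l2dotZr TS TS' rmorphN1.
Qed.

Lemma adjoint_add T S T' S' :
  adjoint_to T S -> adjoint_to T' S' -> adjoint_to (T + T') (S + S').
Proof. by move=> TS TS' x y; rewrite !fctE l2dotDl l2dotDr TS TS'. Qed.

(** From |S y|^2 = <T S y, y>. *)
Lemma adjoint_opbound T S M : adjoint_to T S -> opbound T M -> opbound S M.
Proof.
move=> TS TM y; have [->|Sy0] := eqVneq (l2norm (S y)) 0.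
  exact: le_trans (l2norm_ge0 (T y)) (TM y).
have Syp : 0 < l2norm (S y) by rewrite lt_neqAle eq_sym Sy0 l2norm_ge0.
rewrite -(ler_pM2l Syp) -expr2.
have -> : l2norm (S y) ^+ 2 = complex.Re (l2dot (T (S y)) y).
  by rewrite TS l2dotxx.
apply: le_trans (Re_l2dot_le _ _) _.
by rewrite mulrA (mulrC _ M) ler_wpM2r ?l2norm_ge0.
Qed.

End HilbertSpace.

(** * Etale groupoids and their bisections *)

Section Groupoid.
Variable G : etale_groupoid.
Local Notation mul := (gmul (gpd G)).
Local Notation inv := (ginv (gpd G)).
Local Notation comp a b := (gcomp (gpd G) (a, b)).
Implicit Types (a b c : G) (u : unit_space G).

Lemma unit_inj : injective (@of_unit G).
Proof. exact: val_inj. Qed.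

Lemma of_unit_src a : of_unit (src a) = mul (inv a) a.
Proof. by []. Qed.

Lemma of_unit_rng a : of_unit (rng a) = mul a (inv a).
Proof. by []. Qed.

Lemma invK a : inv (inv a) = a.
Proof. exact: ginvK. Qed.

Lemma rngV a : rng (inv a) = src a.
Proof. by apply: unit_inj; rewrite of_unit_src of_unit_rng invK. Qed.

Lemma srcV a : src (inv a) = rng a.
Proof. by rewrite -rngV invK. Qed.

Let compV a : comp a (inv a). Proof. exact: gcompV. Qed.

Let compVl a : comp (inv a) a.
Proof. by have := compV (inv a); rewrite invK. Qed.

Let mulVKV a : mul (mul a (inv a)) a = a.
Proof. by have := gmulKr (compV a); rewrite ginvK. Qed.

(** If ab exists, then (a^-1 a) b = b forces a^-1 a = b b^-1. Conversely, with v
    this common unit, both a v and v b exist, hence so does (a v) b = a b. *)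
Lemma compP a b : comp a b <-> src a = rng b.
Proof.
split=> [ab|/(congr1 (@of_unit G))].
  apply: unit_inj; rewrite of_unit_src of_unit_rng.
  have [c1 _ e1] := gmulA (compVl a) ab.
  by have := gmulKr c1; rewrite e1 gmulKl// => ->.
rewrite of_unit_src of_unit_rng => e.
have [_ c1 e1] := gmulA (compV a) (compVl a).
have [c2 _ _] := gmulA (compV b) (compVl b).
rewrite -e in c2; have [c3 _ _] := gmulA c1 c2.
by move: c3; rewrite -e1 mulVKV.
Qed.

Lemma rngM a b : src a = rng b -> rng (mul a b) = rng a.
Proof.
move=> /compP ab; have [_ /compP + _] := gmulA (compVl a) ab.
by rewrite srcV.
Qed.

Lemma srcM a b : src a = rng b -> src (mul a b) = src b.
Proof.
move=> /compP ab; have [/compP + _ _] := gmulA ab (compV b).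
by rewrite rngV.
Qed.

Lemma mulKV a b : src a = rng b -> mul (inv a) (mul a b) = b.
Proof. by move=> /compP; exact: gmulKl. Qed.

Lemma mulVK a b : rng a = rng b -> mul a (mul (inv a) b) = b.
Proof. by move=> ab; rewrite -{1}(invK a) mulKV// srcV. Qed.

Lemma mul1 a : mul (of_unit (rng a)) a = a.
Proof. exact: mulVKV. Qed.

Lemma mulu1 a : mul a (of_unit (src a)) = a.
Proof. by rewrite of_unit_src mulVK. Qed.

Lemma unitP u : exists a, u = rng a.
Proof.
have [a _ e] : gunits (gpd G) (of_unit u) by exact: set_valP.
by exists a; apply: unit_inj; rewrite -e.
Qed.

Lemma src_unit u : src (of_unit u) = u.
Proof.
have [a ->] := unitP u; rewrite {1}of_unit_rng srcM ?rngV ?srcV//.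
Qed.

Lemma rng_unit u : rng (of_unit u) = u.
Proof.
by have [a ->] := unitP u; rewrite {1}of_unit_rng rngM// rngV.
Qed.

Lemma inv_unit u : inv (of_unit u) = of_unit u.
Proof.
have vv : mul (of_unit u) (of_unit u) = of_unit u.
  by have := mulu1 (of_unit u); rewrite src_unit.
rewrite -[LHS]mulu1 srcV rng_unit -{2}vv mulKV//.
by rewrite src_unit rng_unit.
Qed.

Lemma gunitsP a : gunits (gpd G) a <-> of_unit (src a) = a.
Proof.
split=> [[b _ <-]|<-]; last exact: set_valP.
by rewrite -of_unit_rng src_unit.
Qed.

End Groupoid.

Section LocalHomeo.
Variables (U V : topologicalType) (f : U -> V).

Lemma homeo_inj X x y : homeo_onto_open f X -> X x -> X y -> f x = f y -> x = y.
Proof.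
by move=> [_ _ [g [_ gf]]] Xx Xy e; rewrite -(gf x Xx) e gf.
Qed.

(** On an open image the relative continuity of the inverse is continuity at
    each point. *)
Lemma homeo_inverse X : homeo_onto_open f X ->
  exists g : V -> U, (forall x, X x -> g (f x) = x) /\
    (forall x, X x -> {for f x, continuous g}).
Proof.
move=> [oV _ [g [cg gf]]]; exists g; split=> // x Xx.
by move: cg; rewrite continuous_open_subspace//; apply; apply/mem_set; exists x.
Qed.

Lemma homeo_sub X Y : open Y -> Y `<=` X ->
  homeo_onto_open f X -> homeo_onto_open f Y.
Proof.
move=> oY YX hX; have [g [gf cg]] := homeo_inverse hX; case: hX => oX cX _.
split; last 2 first.
- exact: continuous_subspaceW cX.
- exists g; split; last by move=> x /YX /gf.
  by apply: continuous_in_subspaceT => _ /set_mem[x /YX Xx <-]; exact: cg.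
rewrite openE => _ [y Yy <-]; rewrite /interior.
have nY : nbhs (g (f y)) Y by rewrite gf; [exact: open_nbhs_nbhs | exact: YX].
have nX : nbhs (f y) (f @` X) by apply: open_nbhs_nbhs; split=> //;
  exists y => //; exact: YX.
near=> v; have [x Xx xv] : (f @` X) v by near: v.
exists x => //; rewrite -(gf x Xx) xv; near: v.
exact: cg (YX _ Yy) _ nY.
Unshelve. all: by end_near. Qed.

Lemma local_homeo_continuous : local_homeo f -> continuous f.
Proof.
move=> lf x; have [X [oX Xx [_ cX _]]] := lf x.
by move: cX; rewrite continuous_open_subspace//; apply; apply/mem_set.
Qed.

End LocalHomeo.

Section EtaleTopology.
Variable G : etale_groupoid.
Local Notation mul := (gmul (gpd G)).
Local Notation inv := (ginv (gpd G)).

Lemma etale_hausdorff : hausdorff_space G.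
Proof. by case: G. Qed.

Lemma etale_locally_compact : locally_compact [set: G].
Proof. by case: G. Qed.

Lemma continuous_inv : continuous (ginv (gpd G)).
Proof. by case: G. Qed.

Lemma local_homeo_rng : local_homeo (@rng G).
Proof. by case: G. Qed.

Lemma local_homeo_src : local_homeo (@src G).
Proof. by case: G. Qed.

Lemma continuous_rng : continuous (@rng G).
Proof. exact: local_homeo_continuous local_homeo_rng. Qed.

Lemma continuous_src : continuous (@src G).
Proof. exact: local_homeo_continuous local_homeo_src. Qed.

Lemma continuous_of_unit : continuous (@of_unit G).
Proof. exact: initial_continuous. Qed.

Lemma unit_hausdorff : hausdorff_space (unit_space G).
Proof.
move=> p q pq; apply: (@unit_inj G); apply: etale_hausdorff => A B nA nB.
have [z [Az Bz]] := pq _ _ (continuous_of_unit nA) (continuous_of_unit nB).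
by exists (of_unit z).
Qed.

Lemma bisection_at (a : G) : exists X, bisection X /\ X a.
Proof.
have [X [oX Xa hX]] := local_homeo_src a;
  have [Y [oY Ya hY]] := local_homeo_rng a.
exists (X `&` Y); split=> //; have oXY := openI oX oY.
by split=> //; [apply: homeo_sub hX | apply: homeo_sub hY].
Qed.

Lemma bisection_open (X : set G) : bisection X -> open X.
Proof. by case. Qed.

Lemma src_inj (X : set G) a b : bisection X -> X a -> X b ->
  src a = src b -> a = b.
Proof. by move=> [_ h _]; exact: homeo_inj. Qed.

Lemma rng_inj (X : set G) a b : bisection X -> X a -> X b ->
  rng a = rng b -> a = b.
Proof. by move=> [_ _ h]; exact: homeo_inj. Qed.

Lemma gsetinvE (X : set G) a : gsetinv (gpd G) X a <-> X (inv a).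
Proof.
split=> [[b Xb <-]|Xa]; first by rewrite invK.
by exists (inv a) => //; rewrite invK.
Qed.

Let homeo_inv (f h : G -> unit_space G) (X : set G) :
  continuous h -> (forall a, h (inv a) = f a) ->
  homeo_onto_open f X -> homeo_onto_open h (gsetinv (gpd G) X).
Proof.
move=> ch hf [oX cX [g [cg gf]]].
have E : h @` gsetinv (gpd G) X = f @` X.
  apply/seteqP; split=> [_ [_ [a Xa <-] <-]|_ [a Xa <-]].
    by exists a.
  by exists (inv a) => //; exists a.
split.
- by rewrite E.
- exact: continuous_subspaceT.
- exists (inv \o g); rewrite E; split.
    move=> x; apply: (@continuous_comp (subspace (f @` X)) _ _ g inv).
      exact: cg.
    exact: continuous_inv.
  by move=> _ [a Xa <-]; rewrite /= hf gf.
Qed.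

Lemma bisection_inv (X : set G) : bisection X -> bisection (gsetinv (gpd G) X).
Proof.
move=> [oX hs hr]; split.
- have -> : gsetinv (gpd G) X = inv @^-1` X.
    by apply/funext => a; apply/propext; exact: gsetinvE.
  by apply: open_comp => // a _; exact: continuous_inv.
- by apply: homeo_inv hr; [exact: continuous_src | exact: srcV].
- by apply: homeo_inv hs; [exact: continuous_rng | exact: rngV].
Qed.

(** Near a unit, an arrow and its source lie in a common bisection, on which
    the source map is injective. *)
Lemma open_units : open (gunits (gpd G)).
Proof.
rewrite openE => a /gunitsP au; have [X [bX Xa]] := bisection_at a.
have nX : nbhs a X by apply: open_nbhs_nbhs; split=> //; exact: bisection_open.
have nX' : nbhs (of_unit (src a)) X by rewrite au.
rewrite /interior; near=> b; apply/gunitsP.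
apply: (src_inj bX); rewrite ?src_unit//; last by near: b.
near: b; apply: (@continuous_comp _ _ _ (@src G) (@of_unit G)) => //.
  exact: continuous_src.
exact: continuous_of_unit.
Unshelve. all: by end_near. Qed.

End EtaleTopology.

(** * Continuous functions with compact support *)

Section ComplexContinuity.
Variables (R : realType) (T : topologicalType).
Implicit Types (f g : T -> R[i]) (x : T).

Lemma continuous_cabsP f x : {for x, continuous f} <->
  forall e : R, 0 < e -> \forall y \near x, cabs (f x - f y) < e.
Proof.
split=> [cf e e0|cf].
  have e0' : 0 < e%:C by rewrite ltcR.
  move/cvgrPdist_lt : cf => /(_ _ e0'); apply: filterS => y.
  by rewrite cabsE ltcR.
apply/cvgrPdist_lt => e e0.
have eR : e = (complex.Re e)%:C.
  by move: e0; rewrite ltcE /= => /andP[/eqP]; case: e => a b /= ->.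
have {}e0 : 0 < complex.Re e by move: e0; rewrite {1}eR ltcR.
by apply: filterS (cf _ e0) => y; rewrite cabsE {2}eR ltcR.
Qed.

Lemma continuous_ReIm f x : {for x, continuous f} <->
  {for x, continuous (fun y => complex.Re (f y))} /\
  {for x, continuous (fun y => complex.Im (f y))}.
Proof.
rewrite continuous_cabsP; split=> [cf|[cr ci] e e0].
  split; apply/cvgrPdist_lt => e e0; apply: filterS (cf e e0) => y;
    apply: le_lt_trans.
  - by have := le_Re_cabs (f x - f y); case: (f x) (f y) => [? ?] [? ?].
  - by have := le_Im_cabs (f x - f y); case: (f x) (f y) => [? ?] [? ?].
have e20 : 0 < e / 2 by rewrite divr_gt0.
move/cvgrPdist_lt : cr => /(_ _ e20) cr;
  move/cvgrPdist_lt : ci => /(_ _ e20) ci.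
apply: filterS2 cr ci => y yr yi; apply: le_lt_trans (le_cabs_ReIm _) _.
by case: (f x) (f y) yr yi => [a b] [c d] /= yr yi; lra.
Qed.

Lemma continuous_cM f g x : {for x, continuous f} -> {for x, continuous g} ->
  {for x, continuous (fun y => f y * g y)}.
Proof.
move=> /continuous_ReIm[fr fi] /continuous_ReIm[gr gi].
apply/continuous_ReIm; split.
  have -> : (fun y => complex.Re (f y * g y)) = (fun y => complex.Re (f y) *
      complex.Re (g y) - complex.Im (f y) * complex.Im (g y)).
    by apply/funext => y; case: (f y) (g y) => [? ?] [? ?].
  by apply: continuousB; apply: continuousM.
have -> : (fun y => complex.Im (f y * g y)) = (fun y => complex.Re (f y) *
    complex.Im (g y) + complex.Im (f y) * complex.Re (g y)).
  by apply/funext => y; case: (f y) (g y) => [? ?] [? ?].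
by apply: continuousD; apply: continuousM.
Qed.

Lemma continuous_cD f g x : {for x, continuous f} -> {for x, continuous g} ->
  {for x, continuous (fun y => f y + g y)}.
Proof.
move=> /continuous_ReIm[fr fi] /continuous_ReIm[gr gi].
apply/continuous_ReIm; split.
  have -> : (fun y => complex.Re (f y + g y)) =
      (fun y => complex.Re (f y) + complex.Re (g y)).
    by apply/funext => y; rewrite Re_add.
  exact: continuousD.
have -> : (fun y => complex.Im (f y + g y)) =
    (fun y => complex.Im (f y) + complex.Im (g y)).
  by apply/funext => y; rewrite Im_add.
exact: continuousD.
Qed.

Lemma continuous_conj f x : {for x, continuous f} ->
  {for x, continuous (fun y => (f y)^*%C)}.
Proof.
move=> /continuous_ReIm[fr fi]; apply/continuous_ReIm; split.
  have -> // : (fun y => complex.Re (f y)^*%C) = (fun y => complex.Re (f y)).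
  by apply/funext => y; case: (f y).
have -> : (fun y => complex.Im (f y)^*%C) = (fun y => - complex.Im (f y)).
  by apply/funext => y; case: (f y).
exact: continuousN.
Qed.

Lemma continuous_realC (h : T -> R) x : {for x, continuous h} ->
  {for x, continuous (fun y => (h y)%:C : R[i])}.
Proof. by move=> ch; apply/continuous_ReIm; split=> //=;
  exact: cst_continuous. Qed.

Lemma continuous_cabs f x : {for x, continuous f} ->
  {for x, continuous (fun y => cabs (f y))}.
Proof.
move=> /continuous_cabsP cf; apply/cvgrPdist_lt => e e0.
apply: filterS (cf e e0) => y; apply: le_lt_trans.
rewrite ler_norml; apply/andP; split.
  have := le_cabsD (f y - f x) (f x); rewrite subrK cabsB; lra.
have := le_cabsD (f x - f y) (f y); rewrite subrK; lra.
Qed.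

Lemma continuous_uniform f (F : R -> T -> R[i]) x :
  (forall e, 0 < e -> {for x, continuous (F e)}) ->
  (forall e, 0 < e -> forall y, cabs (f y - F e y) <= e) ->
  {for x, continuous f}.
Proof.
move=> cF fF; apply/continuous_cabsP => e e0.
have e40 : 0 < e / 4 by rewrite divr_gt0.
have /continuous_cabsP/(_ _ e40) := cF _ e40; apply: filterS => y Fy.
have -> : f x - f y = (f x - F (e / 4) x) + (F (e / 4) x - F (e / 4) y) -
    (f y - F (e / 4) y) by ring.
have := le_cabsD ((f x - F (e / 4) x) + (F (e / 4) x - F (e / 4) y))
  (- (f y - F (e / 4) y)).
have := le_cabsD (f x - F (e / 4) x) (F (e / 4) x - F (e / 4) y).
by rewrite cabsN; have := fF _ e40 x; have := fF _ e40 y; lra.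
Qed.

End ComplexContinuity.

Section Bumps.
Variables (R : realType) (T : ptopologicalType).
Hypotheses (hT : hausdorff_space T) (lcT : locally_compact [set: T]).

Definition bump (U : set T) (h : T -> R) :=
  [/\ continuous h, forall a, 0 <= h a,
      compact (closure [set a | h a != 0]) & closure [set a | h a != 0] `<=` U].

Lemma bump0 U : bump U (cst 0).
Proof.
have E : [set a | (cst 0 : T -> R) a != 0] = set0.
  by apply/seteqP; split=> a //=; rewrite eqxx.
split; rewrite ?E ?closure0 //; last exact: compact0.
by move=> a; exact: cst_continuous.
Qed.

Lemma bumpD U g h : bump U g -> bump U h -> bump U (fun a => g a + h a).
Proof.
move=> [cg g0 kg gU] [ch h0 kh hU].
have sub : closure [set a | g a + h a != 0] `<=`
    closure [set a | g a != 0] `|` closure [set a | h a != 0].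
  rewrite -closureU; apply: closure_subset => a /=.
  by have [->|] := eqVneq (g a) 0; [rewrite add0r; right | left].
split.
- by move=> a; apply: continuousD; [exact: cg a | exact: ch a].
- by move=> a; rewrite addr_ge0.
- by apply: subclosed_compact sub; [exact: closed_closure | exact: compactU].
- by move=> a /sub[/gU|/hU].
Qed.

(** A point of a locally compact Hausdorff space has a neighbourhood V whose
    closure is compact and contained in [U]; complete regularity separates the
    point from the complement of the interior of V. *)
Lemma bump_at (U : set T) a : open U -> U a -> exists2 h, bump U h & h a = 1.
Proof.
move=> oU Ua.
have [W nW [cW clW]] := lcT (x := a) I; rewrite withinET in nW.
have cr := @locally_compact_completely_regular T R lcT hT.
have [V nV VUW] : exists2 V, nbhs a V & closure V `<=` U `&` W.
  exact: (completely_regular_regular cr (filterI (open_nbhs_nbhs (conj oU Ua))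
    nW)).
have nV' : ~ (~` V°) a by apply; exact: nV.
have /(@uniform_separatorP _ R)[f [cf f01 f0 f1]] :=
  cr a _ (open_closedC (open_interior V)) nV'.
have sub : closure [set b | 1 - f b != 0] `<=` closure V.
  apply: closure_subset => b /= fb; apply: interior_subset.
  apply: contrapT => Vb; move/eqP : fb; apply.
  by rewrite (f1 (f b)) ?subrr//; exists b.
exists (fun b => 1 - f b).
  split.
  - by move=> b; apply: continuousB; [exact: cst_continuous | exact: cf].
  - move=> b; have : (range f) (f b) by exists b.
    by move=> /f01; rewrite /= in_itv /= subr_ge0 => /andP[].
  - apply: subclosed_compact cW _; first exact: closed_closure.
    by move=> b /sub /VUW[].
  - by move=> b /sub /VUW[].
by rewrite (f0 (f a)) ?subr0//; exists a.
Qed.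

(** Adding up a finite subcover. It serves both for Urysohn functions and for
    partitions of unity, with different classes [Q]. *)
Lemma compact_sum (Q : (T -> R) -> Prop) (K : set T) : compact K ->
  Q (cst 0) -> (forall g h, Q g -> Q h -> Q (fun a => g a + h a)) ->
  (forall h, Q h -> continuous h /\ forall a, 0 <= h a) ->
  (forall a, K a -> exists2 h, Q h & 1 < h a) ->
  exists2 F, Q F & forall a, K a -> 1 < F a.
Proof.
move=> cK Q0 QD Qh QK.
have /choice[h hP] : forall a, exists h, K a -> Q h /\ 1 < h a.
  move=> a; have [Ka|] := pselect (K a); last by exists (cst 0).
  by have [h] := QK a Ka; exists h.
move: cK; rewrite compact_cover => /(_ _ K (fun a => [set b | 1 < h a b])).
case.
- move=> a /hP[/Qh[ch _] _];
  rewrite (_ : [set b | _] = h a @^-1` [set r | 1 < r])//.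
  by apply: open_comp => [b _|]; [exact: ch | exact: open_gt].
- by move=> a Ka; exists a => //; have [] := hP a Ka.
move=> D DK KD.
have [F QF FP] : exists2 F, Q F &
    forall a b, a \in finmap.enum_fset D -> 1 < h a b -> 1 < F b.
  have : forall a, a \in finmap.enum_fset D -> K a by move=> a /DK /set_mem.
  elim: (finmap.enum_fset D) => [_|c s IH sK]; first by exists (cst 0).
  have [a as_|F QF FP] := IH; first by apply: sK; rewrite inE as_ orbT.
  have [Qc _] := hP c (sK c (mem_head _ _)).
  exists (fun b => h c b + F b); first exact: QD.
  have [_ hc0] := Qh _ Qc; have [_ F0] := Qh _ QF.
  move=> a b; rewrite inE => /orP[/eqP ->|as_] hab.
    by apply: lt_le_trans hab _; rewrite lerDl.
  by apply: lt_le_trans (FP _ _ as_ hab) _; rewrite lerDr.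
by exists F => // b /KD[a /= aD hab]; exact: FP hab.
Qed.

Lemma urysohn_compact (K U : set T) : compact K -> open U -> K `<=` U ->
  exists2 h, bump U h & (forall a, h a <= 1) /\ (forall a, K a -> h a = 1).
Proof.
move=> cK oU KU.
have [F [cF F0 kF FU] F1] : exists2 F, bump U F & forall a, K a -> 1 < F a.
  apply: compact_sum cK (bump0 U) _ _ _; first exact: bumpD.
    by move=> h [].
  move=> a /KU Ua; have [h bh h1] := bump_at oU Ua.
  by exists (fun b => h b + h b); [exact: bumpD | rewrite h1; lra].
have sub : closure [set a | Num.min 1 (F a) != 0] `<=` closure [set a | F a !=
  0].
  apply: closure_subset => a /=; apply: contra_neq => ->.
  by rewrite min_r// ler01.
exists (fun a => Num.min 1 (F a)).
  split.
  - by move=> a; apply: continuous_min; [exact: cst_continuous | exact: cF].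
  - by move=> a; rewrite le_min ler01 F0.
  - by apply: subclosed_compact kF sub; exact: closed_closure.
  - by move=> a /sub /FU.
split; first by move=> a; rewrite ge_min lexx.
by move=> a /F1 Fa; rewrite min_l// ltW.
Qed.

End Bumps.

Section CompactSupport.
Variables (R : realType) (G : etale_groupoid).
Implicit Types (f g : G -> R[i]) (X : set G).

Lemma csupp_in f a : f a != 0 -> csupp f a.
Proof. by move=> fa; apply: subset_closure. Qed.

Lemma csuppN f a : ~ csupp f a -> f a = 0.
Proof. by move=> fa; apply/eqP; apply: contra_notT fa => /csupp_in. Qed.

Lemma csupp_sub f g : (forall a, g a = 0 -> f a = 0) -> csupp f `<=` csupp g.
Proof. by move=> gf; apply: closure_subset => a /=; apply: contra_neq;
  exact: gf. Qed.

Lemma Cc_sub f g : continuous f -> (forall a, g a = 0 -> f a = 0) ->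
  Cc g -> Cc f.
Proof.
move=> cf gf [_ kg]; split=> //.
by apply: subclosed_compact kg (csupp_sub gf); exact: closed_closure.
Qed.

Lemma Cc0 : Cc (0 : G -> R[i]).
Proof.
split; first by move=> a; exact: cst_continuous.
rewrite /csupp (_ : [set a | _] = set0) ?closure0; first exact: compact0.
by apply/seteqP; split=> a //=; rewrite eqxx.
Qed.

Lemma CcD f g : Cc f -> Cc g -> Cc (f + g).
Proof.
move=> [cf kf] [cg kg]; split.
  by move=> a; apply: continuous_cD; [exact: cf | exact: cg].
have sub : csupp (f + g) `<=` csupp f `|` csupp g.
  rewrite -closureU; apply: closure_subset => a /=; rewrite !fctE.
  by have [->|] := eqVneq (f a) 0; [rewrite add0r; right | left].
by apply: subclosed_compact sub; [exact: closed_closure | exact: compactU].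
Qed.

Lemma CcM f g : continuous g -> Cc f -> Cc (fun a => g a * f a).
Proof.
move=> cg Cf; refine (Cc_sub _ _ Cf) => [a|a ->]; last by rewrite mulr0.
by apply: continuous_cM; [exact: cg | have [+ _] := Cf; exact].
Qed.

Lemma Cc_onM X f g : continuous g -> Cc_on X f -> Cc_on X (fun a => g a * f a).
Proof.
move=> cg [Cf fX]; split; first exact: CcM.
by apply: subset_trans fX; apply: csupp_sub => a ->; rewrite mulr0.
Qed.

Lemma Cc_bump (U : set G) (h : G -> R) : bump U h ->
  Cc_on U (fun a => (h a)%:C : R[i]).
Proof.
move=> [ch h0 kh hU]; have E : csupp (fun a => (h a)%:C : R[i]) =
  closure [set a | h a != 0].
  by congr closure; apply/seteqP; split=> a /=;
    rewrite (fmorph_eq0 (real_complex R)).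
split; rewrite ?E//; split; rewrite ?E// => a.
by apply: continuous_realC; exact: ch.
Qed.

(** A partition of unity cuts a function of [Cc] into functions supported in
    bisections. The sum [F] of the bumps is only known to exceed 1 on the support
    of f, which is enough for f / F to be continuous. *)
Lemma Cc_ind (P : (G -> R[i]) -> Prop) :
  P 0 -> (forall f g, Cc f -> Cc g -> P f -> P g -> P (f + g)) ->
  (forall X f, bisection X -> Cc_on X f -> P f) ->
  forall f, Cc f -> P f.
Proof.
move=> P0 PD PX f [cf kf].
(* Q F: the induction hypothesis holds for all the multiples g F. *)
pose Q (F : G -> R) := (continuous F /\ forall a, 0 <= F a) /\
  (forall g, continuous g -> Cc (fun a => g a * (F a)%:C : R[i]) /\
                             P (fun a => g a * (F a)%:C)).
have [F [[cF F0] PF] F1] : exists2 F, Q F & forall a, csupp f a -> 1 < F a.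
  apply: compact_sum kf _ _ _ _.
  - split; first by split=> // a; exact: cst_continuous.
    move=> g _; have -> : (fun a => g a * ((cst 0 : G -> R) a)%:C) = 0 :> (G ->
      R[i]).
      by apply/funext => a; rewrite mulr0.
    by split; [exact: Cc0 | exact: P0].
  - move=> F H [[cF F0] PF] [[cH H0] PH]; split.
      split=> a; last by rewrite addr_ge0.
      by apply: continuousD; [exact: cF | exact: cH].
    move=> g cg; have [C1 P1] := PF g cg; have [C2 P2] := PH g cg.
    have -> : (fun a => g a * (F a + H a)%:C) =
        ((fun a => g a * (F a)%:C) + (fun a => g a * (H a)%:C)) :> (G -> R[i]).
      by apply/funext => a; rewrite !fctE rmorphD /= mulrDr.
    by split; [exact: CcD | exact: PD].
  - by move=> h [].
  - move=> a _; have [X [bX Xa]] := bisection_at a.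
    have [h bh h1] := bump_at R (@etale_hausdorff G) (@etale_locally_compact G)
      (bisection_open bX) Xa.
    have bhh := bumpD bh bh; exists (fun b => h b + h b); last by rewrite h1;
      lra.
    split; first by case: bhh.
    by move=> g cg; have CX := Cc_onM cg (Cc_bump bhh); split;
      [case: CX | exact: PX CX].
pose g a := f a * ((F a)^-1)%:C.
have cg : continuous g.
  move=> a; have [fa|fa] := pselect (csupp f a).
    apply: (@continuous_cM _ _ f (fun b => ((F b)^-1)%:C)); first exact: cf.
    apply: (@continuous_realC _ _ (fun b => (F b)^-1)).
    apply: continuousV; last exact: cF.
    by rewrite gt_eqF// (lt_trans ltr01)//; exact: F1.
  have na : nbhs a (~` csupp f).
    by apply: open_nbhs_nbhs; split=> //; exact/closed_openC/closed_closure.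
  have g0 b : (~` csupp f) b -> g b = 0 by move=> /csuppN; rewrite /g => ->;
    rewrite mul0r.
  apply/continuous_cabsP => e e0; apply: filterS na => b nb.
  by rewrite (g0 a)// (g0 b)// subrr cabs0.
have -> : f = (fun a => g a * (F a)%:C).
  apply/funext => a; have [fa|fa] := eqVneq (f a) 0;
    first by rewrite /g fa !mul0r.
  rewrite /g -mulrA -rmorphM /= mulVf ?rmorph1 ?mulr1// gt_eqF//.
  by rewrite (lt_trans ltr01)//; exact/F1/csupp_in.
by have [] := PF g cg.
Qed.

End CompactSupport.

(** * Convolution *)

Section FibreSums.
Variables (I : choiceType) (J : Type) (V : nmodType).
Implicit Types (p : I -> J) (X : set I) (k : I -> V).

(** Sum over the fibres of [p] in [X]. When [p] is injective on [X], it is the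
    function k o (p|X)^-1 on p(X), extended by zero. *)
Definition transfer p X k (j : J) : V := \sum_(c \in X `&` p @^-1` [set j]) k c.

Lemma transfer_in p X k c : (forall b, X b -> p b = p c -> b = c) -> X c ->
  transfer p X k (p c) = k c.
Proof.
move=> inj Xc; rewrite /transfer.
rewrite (_ : X `&` _ = [set c]) ?fsbig_set1//; apply/seteqP;
  split=> [b []|b ->//].
exact: inj.
Qed.

Lemma transfer_out p X k j : (forall c, X c -> p c = j -> k c = 0) ->
  transfer p X k j = 0.
Proof. by move=> k0; apply: fsbig1 => c [Xc]; exact: k0. Qed.

End FibreSums.

Section Convolution.
Variables (R : realType) (G : etale_groupoid).
Local Notation mul := (gmul (gpd G)).
Local Notation inv := (ginv (gpd G)).
Implicit Types (f g x y : G -> R[i]) (X : set G).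

(** A factorization a = c d is determined by c, which ranges over the arrows
    with the range of a. *)
Lemma convE f x a :
  conv f x a = transfer (@rng G) setT (fun c => f c * x (mul (inv c) a))
    (rng a).
Proof.
rewrite /conv /transfer setTI.
pose e c : G * G := (c, mul (inv c) a).
have be : set_bij (@rng G @^-1` [set rng a])
    [set p | gcomp (gpd G) p /\ mul p.1 p.2 = a] e.
  split.
  - move=> c /= ca; split; last exact: mulVK.
    by apply/compP; rewrite rngM ?rngV// srcV.
  - by move=> c d _ _ [].
  - move=> [c d] /= [/compP cd da]; exists c; first by rewrite /= -da rngM.
    by rewrite /e -da mulKV.
by rewrite (reindex_fsbig e _ _ _ be).
Qed.

(** The convolution is computed on any set of arrows that contains the support
    of [f] in the range fibre; taking it finite gives additivity. *)
Lemma conv_widen f x a (S : set G) :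
  (forall c, S c -> rng c = rng a) ->
  (forall c, rng c = rng a -> f c != 0 -> S c) ->
  conv f x a = \sum_(c \in S) f c * x (mul (inv c) a).
Proof.
move=> Sa fS; rewrite convE /transfer setTI; apply/esym/fsbig_widen.
  by move=> c /Sa.
move=> c [/= ca nS]; apply/eqP; rewrite mulf_eq0.
by have [//|/(fS c ca)] := eqVneq (f c) 0.
Qed.

Definition fibre_finite f :=
  forall u, finite_set [set c | rng c = u /\ f c != 0].

Lemma fibre_finiteD f g : fibre_finite f -> fibre_finite g ->
  fibre_finite (f + g).
Proof.
move=> ff fg u; apply: (@sub_finite_set _ _
    ([set c | rng c = u /\ f c != 0] `|` [set c | rng c = u /\ g c != 0])).
  move=> c /= [cu]; rewrite fctE; have [->|fc _] := eqVneq (f c) 0;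
    last by left.
  by rewrite add0r; right.
by rewrite finite_setU.
Qed.

Lemma conv_addl f g x a : fibre_finite f -> fibre_finite g ->
  conv (f + g) x a = conv f x a + conv g x a.
Proof.
move=> ff fg; pose S := [set c | rng c = rng a /\ f c != 0] `|`
  [set c | rng c = rng a /\ g c != 0].
have fS : finite_set S by rewrite finite_setU.
have Sa c : S c -> rng c = rng a by case=> -[].
rewrite (@conv_widen f x a S Sa); last by left.
rewrite (@conv_widen g x a S Sa); last by right.
rewrite (conv_widen x Sa); last first.
  move=> c ca; rewrite fctE; have [->|fc _] := eqVneq (f c) 0; last by left.
  by rewrite add0r; right.
rewrite -fsbig_split//; apply: eq_fsbigr => c _.
by rewrite fctE mulrDl.
Qed.

Lemma conv_linear f x y (z : R[i]) a : fibre_finite f ->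
  conv f (fun c => z * x c + y c) a = z * conv f x a + conv f y a.
Proof.
move=> ff; have Sa c : [set c | rng c = rng a /\ f c != 0] c -> rng c = rng a.
  by case.
rewrite !(conv_widen _ Sa)// mulr_fsumr -fsbig_split//.
by apply: eq_fsbigr => c _; rewrite mulrDr mulrCA.
Qed.

(** A function supported where [rng] is injective has at most one term in each
    convolution sum. *)
Lemma conv_in f x X a c : (forall b d, X b -> X d -> rng b = rng d -> b = d) ->
  (forall b, ~ X b -> f b = 0) -> X c -> rng c = rng a ->
  conv f x a = f c * x (mul (inv c) a).
Proof.
move=> inj fX Xc ca; rewrite (@conv_widen f x a [set c]) ?fsbig_set1//.
  by move=> b ->.
move=> b ba fb; apply: inj => //; last by rewrite ba ca.
by apply: contrapT => /fX /eqP; rewrite (negPf fb).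
Qed.

Lemma conv_out f x a : (forall c, rng c = rng a -> f c = 0) -> conv f x a = 0.
Proof.
by move=> f0; rewrite convE; apply: transfer_out => c _ /f0 ->; rewrite mul0r.
Qed.

(** In the sum at a, the only term that meets the unit u is c = a. *)
Lemma conv_delta f (u : unit_space G) a :
  conv f (delta R (of_unit u)) a = if src a == u then f a else 0.
Proof.
have key c : rng c = rng a -> c != a -> delta R (of_unit u) (mul (inv c) a) =
  0 :> R[i].
  move=> ca nca; rewrite deltaE; case: eqVneq => // e; exfalso.
  move/eqP : nca; apply; have ru : rng (of_unit u) = src c.
    by rewrite -e rngM ?rngV ?srcV.
  by rewrite rng_unit in ru; rewrite -(mulVK ca) e ru mulu1.
rewrite (_ : conv _ _ _ = f a * (src a == u)%:R); last first.
  rewrite convE /transfer -(fsbig_widen [set a]) ?fsbig_set1.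
  - by rewrite deltaE -of_unit_src.
  - by move=> c ->.
  - move=> c [[_ ca] /eqP nca].
    change (f c * delta R (of_unit u) (mul (inv c) a) = 0).
    by rewrite key ?mulr0.
by case: ifP; rewrite ?mulr1 ?mulr0.
Qed.

Lemma ext0_unit (b : unit_space G -> R[i]) u : ext0 b (of_unit u) = b u.
Proof. by rewrite /ext0 valK. Qed.

Lemma ext0_out (b : unit_space G -> R[i]) a : ~ gunits (gpd G) a -> ext0 b a =
  0.
Proof. by move=> na; rewrite /ext0 insubN//; apply/negP; rewrite inE. Qed.

Lemma conv_ext0 (b : unit_space G -> R[i]) x a :
  conv (ext0 b) x a = b (rng a) * x a.
Proof.
rewrite (@conv_in _ _ (gunits (gpd G)) _ (of_unit (rng a))).
- by rewrite ext0_unit inv_unit mul1.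
- move=> c d /gunitsP <- /gunitsP <-; rewrite !rng_unit => ->//.
- by move=> c /ext0_out ->.
- by apply/gunitsP; rewrite src_unit.
- by rewrite rng_unit.
Qed.

Definition star f : G -> R[i] := fun a => (f (inv a))^*%C.

Lemma starK f : star (star f) = f.
Proof. by apply/funext => a; rewrite /star conjcK invK. Qed.

Lemma starD f g : star (f + g) = star f + star g.
Proof. by apply/funext => a; rewrite /star !fctE rmorphD. Qed.

Lemma csupp_star f : csupp (star f) `<=` inv @` csupp f.
Proof.
move=> a sa; exists (inv a); rewrite ?invK// => U nU.
have nU' : nbhs a (inv @^-1` U) by apply: continuous_inv; rewrite /= ?invK.
have [b [/= fb Ub]] := sa _ nU'; exists (inv b); split=> //=.
by apply: contra_neq fb; rewrite /star => ->; rewrite conjc0.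
Qed.

Lemma Cc_star f : Cc f -> Cc (star f).
Proof.
move=> [cf kf]; split.
  move=> a; apply: continuous_conj; apply: (@continuous_comp _ _ _ inv f).
    exact: continuous_inv.
  exact: cf.
apply: subclosed_compact (csupp_star (f := f)); first exact: closed_closure.
by apply: continuous_compact => //; apply: continuous_subspaceT;
  exact: continuous_inv.
Qed.

Lemma Cc_on_star X f : Cc_on X f -> Cc_on (gsetinv (gpd G) X) (star f).
Proof.
move=> [/Cc_star Cf fX]; split=> // a /csupp_star[b sb <-].
by exists b => //; exact: fX.
Qed.

Lemma Cc_on_out X f a : Cc_on X f -> ~ X a -> f a = 0.
Proof. by move=> [_ fX] Xa; apply: csuppN => /fX. Qed.

Lemma bounded_Cc f : Cc f -> exists2 M, 0 <= M & forall a, cabs (f a) <= M.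
Proof.
move=> [cf kf]; have cc : continuous (fun a => cabs (f a)).
  by move=> a; apply: continuous_cabs; exact: cf.
have /compact_bounded[M [_ MP]] :=
  continuous_compact (continuous_subspaceT cc) kf.
have M1 : M < `|M| + 1 by rewrite (le_lt_trans (ler_norm _))// ltrDl.
exists (`|M| + 1) => [|a]; first by rewrite addr_ge0.
have [fa|/csuppN ->] := pselect (csupp f a); last by rewrite cabs0 addr_ge0.
by apply: le_trans (ler_norm _) _; apply: (MP _ M1); exists a.
Qed.

End Convolution.

(** * The left regular representation *)

Section LeftRegular.
Variables (R : realType) (G : etale_groupoid).
Local Notation mul := (gmul (gpd G)).
Local Notation inv := (ginv (gpd G)).
Local Notation H := (l2 R G).
Implicit Types (f g : G -> R[i]) (x y : H) (X : set G).
Implicit Types b : unit_space G -> R[i].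

Lemma lreg_fun f x y : (forall a, y a = conv f x a) -> lreg f x = y.
Proof.
move=> fxy; have e : conv f x = y by apply/funext => a; rewrite fxy.
by rewrite /lreg e; apply: val_inj; rewrite val_insubd (l2P y).
Qed.

Lemma fibre_finite_Cc f : Cc f -> fibre_finite f.
Proof.
move: f; apply: Cc_ind => [u|f g _ _|X f bX Cf u].
- by rewrite (_ : [set _ | _] = set0)// -subset0 => c /= [_]; rewrite eqxx.
- exact: fibre_finiteD.
have [[c [Xc cu]]|noc] := pselect (exists c, X c /\ rng c = u).
  apply: (@sub_finite_set _ _ [set c]) => // d /= [du fd].
  apply: (rng_inj bX) => //; last by rewrite cu.
  by apply: contrapT => /(Cc_on_out Cf) /eqP; rewrite (negPf fd).
rewrite (_ : [set _ | _] = set0)// -subset0 => c /= [cu fc]; apply: noc.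
exists c; split=> //.
by apply: contrapT => /(Cc_on_out Cf) /eqP; rewrite (negPf fc).
Qed.

(** Left translation by an open bisection [X], a |-> c^-1 a with c the point of
    [X] whose range is that of a. *)
Section Translation.
Variables (X : set G) (bX : bisection X).

Let D := [set a : G | exists c, X c /\ rng c = rng a].
Let D' := [set a : G | exists c, X c /\ src c = rng a].
Let s a := xget point [set c | X c /\ rng c = rng a].

Let sP a : D a -> X (s a) /\ rng (s a) = rng a.
Proof. by move=> [c cP]; rewrite /s; case: xgetP => [d _ //|/(_ c)]. Qed.

Let translate a := mul (inv (s a)) a.

Let rng_translate a : D a -> rng (translate a) = src (s a).
Proof. by move=> /sP[_ sa]; rewrite /translate rngM ?rngV// srcV. Qed.

Let translate_bij : set_bij D D' translate.
Proof.
split.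
- move=> a Da; exists (s a); have [Xs _] := sP Da.
  by split=> //; rewrite rng_translate.
- move=> a a' /set_mem Da /set_mem Da' e.
  have [Xs sa] := sP Da; have [Xs' sa'] := sP Da'.
  have ss : s a = s a'.
    by apply: (src_inj bX) => //; rewrite -!rng_translate// e.
  by rewrite -(mulVK sa) -(mulVK sa') -/(translate a) -/(translate a') e ss.
- move=> a [c [Xc ca]]; have Dca : D (mul c a) by exists c; rewrite rngM.
  exists (mul c a) => //; have [Xs sa] := sP Dca.
  have -> // : translate (mul c a) = mul (inv c) (mul c a).
    by congr (mul (inv _) _); apply: (rng_inj bX) => //; rewrite sa rngM.
  by rewrite mulKV.
Qed.

Variables (f : G -> R[i]) (fX : forall a, ~ X a -> f a = 0).

Let conv_translate x a : D a -> conv f x a = f (s a) * x (translate a).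
Proof.
by move=> /sP[Xs sa]; apply: (conv_in x _ fX) => // c d; exact: rng_inj.
Qed.

Let conv_out_D x a : ~ D a -> conv f x a = 0.
Proof.
move=> nD; apply: conv_out => c ca; apply: fX => Xc; apply: nD; by exists c.
Qed.

(** Translation is a partial permutation of the basis of l2(G), so that the sup
    norm of [f] bounds the operator norm. *)
Lemma normsq_conv_bisection (M : R) x : (forall a, cabs (f a) <= M) ->
  (normsq (conv f x) <= ((M * l2norm x) ^+ 2)%:E)%E.
Proof.
move=> fM; have M0 : 0 <= M by apply: le_trans (fM point); exact: cabs_ge0.
pose u a := if `[< D a >] then ((M ^+ 2) * cabs (x (translate a)) ^+ 2)%:E else
  0%E.
pose v a := if `[< D' a >] then ((M ^+ 2) * cabs (x a) ^+ 2)%:E else 0%E.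
apply: (@le_trans _ _ (\esum_(a in [set: G]) u a)%E).
  apply: le_esum => a _; rewrite /u; case: asboolP => [Da|/conv_out_D ->].
    rewrite conv_translate// lee_fin cabsM exprMn ler_wpM2r ?sqr_ge0//.
    by rewrite ler_sqr ?nnegrE ?cabs_ge0.
  by rewrite cabs0 expr0n.
rewrite (@esum_reindex _ _ _ D D' translate translate_bij u v); last 3 first.
- move=> a Da; rewrite /u /v asboolT// asboolT//.
  by have [h _ _] := translate_bij; exact: h.
- by move=> a Da; rewrite /u asboolF.
- by move=> a Da; rewrite /v asboolF.
rewrite exprMn EFinM -normsqE -esumZ ?sqr_ge0//; last by move=> a;
  exact: sqr_ge0.
apply: le_esum => a _; rewrite /v; case: asboolP => // _.
by rewrite lee_fin mulr_ge0// sqr_ge0.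
Qed.

(** The translation by X^-1 inverts the translation by [X], and [star f] lives
    on X^-1. *)
Lemma csum_conv_bisection x y :
  csum (fun a => conv f x a * (y a)^*%C) =
  csum (fun a => x a * (conv (star f) y a)^*%C).
Proof.
apply: (csum_reindex translate_bij) => [a Da|a Da|a Da]; last 2 first.
- by rewrite conv_out_D// mul0r.
- rewrite (@conv_out _ _ (star f)) ?conjc0 ?mulr0// => c ca.
  rewrite /star fX ?conjc0// => Xc; apply: Da; exists (inv c).
  by rewrite srcV.
have [Xs sa] := sP Da; rewrite conv_translate//.
rewrite (@conv_in _ _ (star f) y (gsetinv (gpd G) X) (translate a) (inv (s a))).
- rewrite /star invK /translate mulVK// rmorphM /= conjcK.
  by rewrite -mulrA mulrCA.
- by move=> c d; exact: rng_inj (bisection_inv bX).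
- by move=> c nc; rewrite /star fX ?conjc0// => Xc; apply/nc/gsetinvE.
- by apply/gsetinvE; rewrite invK.
- by rewrite rngV rng_translate.
Qed.

End Translation.

Definition conv_bounded f (M : R) :=
  forall x, exists y : H, (forall a, y a =
    conv f x a) /\ l2norm y <= M * l2norm x.

(** [lreg] takes the value 0 where the convolution is not square summable; a
    norm bound exhibits the convolution as a vector. *)
Lemma square_summable_conv (f x : G -> R[i]) (M : R) : (0 <= M) ->
  (normsq (conv f x) <= (M ^+ 2)%:E)%E ->
  exists y : H, (forall a, y a = conv f x a) /\ l2norm y <= M.
Proof.
move=> M0 fxM; have sy : conv f x \in @square_summable R G.
  by apply/asboolP; apply: le_lt_trans fxM (ltry _).
by exists (L2 sy); split=> //; exact: l2norm_le.
Qed.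

Lemma conv_bounded_Cc f : Cc f -> exists2 M, 0 <= M & conv_bounded f M.
Proof.
move: f; apply: Cc_ind => [|f g Cf Cg [M M0 fM] [N N0 gN]|X f bX [Cf fX]].
- exists 0 => // x; exists 0; split=> [a|]; last by rewrite l2norm0 mul0r.
  by rewrite conv_out.
- exists (M + N); first exact: addr_ge0.
  move=> x; have [y [fy yM]] := fM x; have [z [gz zN]] := gN x.
  exists (y + z); split=> [a|].
    by rewrite l2D fy gz conv_addl//; exact: fibre_finite_Cc.
  by rewrite mulrDl (le_trans (l2normD _ _))// lerD.
- have [M M0 fM] := bounded_Cc Cf; exists M => // x.
  apply: square_summable_conv; first by rewrite mulr_ge0// l2norm_ge0.
  apply: (normsq_conv_bisection bX) fM => a nXa.
  exact: Cc_on_out (conj Cf fX) nXa.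
Qed.

Lemma lregE f x a : Cc f -> lreg f x a = conv f x a.
Proof.
by move=> /conv_bounded_Cc[M _ /(_ x)[y [fy _]]]; rewrite (lreg_fun fy).
Qed.

Lemma lreg_linear f : Cc f -> linear (@lreg R G f).
Proof.
move=> Cf z x y; apply: lreg_fun => a; rewrite l2D l2Z !lregE//.
by rewrite -conv_linear//; exact: fibre_finite_Cc.
Qed.

Lemma lreg_opbound f : Cc f -> exists2 M, 0 <= M & opbound (@lreg R G f) M.
Proof.
move=> /conv_bounded_Cc[M M0 fM]; exists M => // x.
by have [y [fy yM]] := fM x; rewrite (lreg_fun fy).
Qed.

Lemma lregD f g : Cc f -> Cc g -> lreg (f + g) = lreg f + lreg g :> (H -> H).
Proof.
move=> Cf Cg; apply/funext => x; apply: lreg_fun => a.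
by rewrite fctE l2D !lregE// conv_addl//; exact: fibre_finite_Cc.
Qed.

Lemma lreg0 : lreg 0 = 0 :> (H -> H).
Proof.
by apply/funext => x; apply: lreg_fun => a; rewrite conv_out.
Qed.

Lemma lreg_adjoint f : Cc f -> adjoint_to (lreg f) (@lreg R G (star f)).
Proof.
move: f; apply: Cc_ind => [|f g Cf Cg fA gA|X f bX Cf].
- have -> : star 0 = 0 :> (G -> R[i]) by apply/funext => a;
  rewrite /star conjc0.
  rewrite lreg0 => x y; change (l2dot (0 : H) y = l2dot x (0 : H)).
  by rewrite -(scale0r x) l2dotZl l2dotZr conjc0 !mul0r.
- rewrite starD (lregD Cf Cg) (lregD (Cc_star Cf) (Cc_star Cg)).
  exact: adjoint_add.
- move=> x y; have [Cf' _] := Cf; have Cs := Cc_star Cf'.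
  transitivity (csum (fun a => conv f x a * (y a)^*%C)).
    by congr csum; apply/funext => a; rewrite lregE.
  rewrite (csum_conv_bisection bX); last by move=> a; exact: Cc_on_out.
  by congr csum; apply/funext => a; rewrite lregE.
Qed.

Lemma opstar_lreg f : Cc f -> opstar (lreg f) = @lreg R G (star f).
Proof. by move=> /lreg_adjoint; exact: opstarE. Qed.

Lemma C0_bounded b : C0 b -> exists2 M, 0 <= M & forall u, cabs (b u) <= M.
Proof.
move=> [cb kb]; have cc : continuous (fun u => cabs (b u)).
  by move=> u; apply: continuous_cabs; exact: cb.
have /compact_bounded[M [_ MP]] :=
  continuous_compact (continuous_subspaceT cc) (kb 1 ltr01).
have M1 : M < `|M| + 1 by rewrite (le_lt_trans (ler_norm _))// ltrDl.
exists (`|M| + 1) => [|u]; first by rewrite addr_ge0.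
have [u1|u1] := leP 1 (cabs (b u)).
  by apply: le_trans (ler_norm _) _; apply: (MP _ M1); exists u.
by apply: le_trans (ltW u1) _; rewrite lerDr.
Qed.

Lemma diag_conv b (M : R) x : 0 <= M -> (forall u, cabs (b u) <= M) ->
  (forall a, diag b x a = b (rng a) * x a) /\ l2norm (diag b x) <= M * l2norm x.
Proof.
move=> M0 bM.
have [y [yE yM]] : exists y : H, (forall a, y a = conv (ext0 b) x a) /\
    l2norm y <= M * l2norm x.
  apply: square_summable_conv; first by rewrite mulr_ge0 ?l2norm_ge0.
  rewrite exprMn EFinM -normsqE -esumZ ?sqr_ge0//; last by move=> a;
    exact: sqr_ge0.
  apply: le_esum => a _; rewrite conv_ext0 lee_fin cabsM exprMn.
  by rewrite ler_wpM2r ?sqr_ge0// ler_sqr ?nnegrE ?cabs_ge0.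
have -> : diag b x = y by exact: lreg_fun.
by split=> // a; rewrite yE conv_ext0.
Qed.

Lemma diagE b x a : C0 b -> diag b x a = b (rng a) * x a.
Proof. by move=> /C0_bounded[M M0 bM]; have [] := diag_conv x M0 bM. Qed.

Lemma diag_opbound b (M : R) : 0 <= M -> (forall u, cabs (b u) <= M) ->
  opbound (@diag R G b) M.
Proof. by move=> M0 bM x; have [] := diag_conv x M0 bM. Qed.

Lemma diag_linear b : C0 b -> linear (@diag R G b).
Proof.
move=> Cb z x y; apply: l2_inj => a; rewrite l2D l2Z !diagE// l2D l2Z.
by rewrite mulrDr mulrCA.
Qed.

Lemma Ered_diag b : C0 b -> Ered (diag b) = b.
Proof.
move=> Cb; apply/funext => u; rewrite /Ered diagE// rng_unit deltaE eqxx.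
by rewrite mulr1.
Qed.

Lemma undiagK b : C0 b -> undiag (@diag R G b) = b.
Proof.
move=> Cb; rewrite /undiag; case: xgetP => [b' _ [Cb' e]|/(_ b)]; last by case.
by rewrite -(Ered_diag Cb') e Ered_diag.
Qed.

Lemma undiag_Ered T : Diag T -> undiag T = @Ered R G T.
Proof. by move=> [b Cb <-]; rewrite undiagK// Ered_diag. Qed.

Lemma lreg_diag f b : Cc f -> C0 b ->
  lreg f \o diag b = @lreg R G (fun c => b (src c) * f c).
Proof.
move=> Cf Cb; have cb : continuous (fun c : G => b (src c)).
  move=> c; apply: (@continuous_comp _ _ _ (@src G) b);
    first exact: continuous_src.
  by have [+ _] := Cb; exact.
apply/funext => x; apply: l2_inj => a; rewrite [LHS](lregE _ _ Cf) lregE;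
  last exact: CcM.
rewrite !convE /transfer; apply: eq_fsbigr => c /set_mem[_ /= ca].
by rewrite diagE// rngM ?rngV ?srcV// mulrCA mulrA.
Qed.

Lemma diag_lreg f b : Cc f -> C0 b ->
  diag b \o lreg f = @lreg R G (fun c => b (rng c) * f c).
Proof.
move=> Cf Cb; have cb : continuous (fun c : G => b (rng c)).
  move=> c; apply: (@continuous_comp _ _ _ (@rng G) b);
    first exact: continuous_rng.
  by have [+ _] := Cb; exact.
apply/funext => x; apply: l2_inj => a;
  rewrite [LHS](diagE _ _ Cb) (lregE _ _ Cf) lregE;
  last exact: CcM.
rewrite !convE /transfer mulr_fsumr; apply: eq_fsbigr => c /set_mem[_ /= ca].
by rewrite ca mulrA.
Qed.

(** The operator f b f^* is the multiplication by the function
    r(c) |-> |f(c)|^2 b(s(c)) of units: f^* is carried by X^-1, so it brings the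
    arrow c^-1 a, of range s(c), back to a. *)
Lemma conv_conj X f (b : unit_space G -> R[i]) (x : G -> R[i]) a :
  bisection X -> Cc_on X f ->
  conv f (fun d => b (rng d) * conv (star f) x d) a =
  transfer (@rng G) X (fun c => (cabs (f c) ^+ 2)%:C * b (src c)) (rng a) * x a.
Proof.
move=> bX Cf; have fX c : ~ X c -> f c = 0 by exact: Cc_on_out Cf.
have [[c [Xc ca]]|noc] := pselect (exists c, X c /\ rng c = rng a); last first.
  rewrite conv_out => [|c ca].
    by rewrite transfer_out ?mul0r// => c Xc ca; exfalso; apply: noc; exists c.
  by apply: fX => Xc; apply: noc; exists c.
rewrite -ca transfer_in//; last by move=> d Xd; apply: (rng_inj bX).
have injX d e : X d -> X e -> rng d = rng e -> d = e by exact: rng_inj.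
rewrite (conv_in _ injX fX Xc ca).
have rca : rng (mul (inv c) a) = src c by rewrite rngM ?rngV// srcV.
rewrite rca (@conv_in _ _ _ _ (gsetinv (gpd G) X) _ (inv c)).
- by rewrite /star invK mulVK// -mul_conjC; ring.
- by move=> ? ?; exact: rng_inj (bisection_inv bX).
- by move=> d nd; rewrite /star fX ?conjc0// => Xd; apply/nd/gsetinvE.
- by apply/gsetinvE; rewrite invK.
- by rewrite rngV rca.
Qed.

End LeftRegular.

(** * Functions on the unit space and the reduced algebra *)

Section UnitSpace.
Variables (R : realType) (G : etale_groupoid).
Local Notation mul := (gmul (gpd G)).
Local Notation inv := (ginv (gpd G)).
Implicit Types (b : unit_space G -> R[i]) (X : set G) (p : G -> unit_space G).

Lemma closed_cabs_ge b (e : R) : continuous b ->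
  closed [set u | e <= cabs (b u)].
Proof.
move=> cb; rewrite (_ : [set u | _] =
  (fun u => cabs (b u)) @^-1` [set r | e <= r])//.
apply: preimage_closed => [u _|]; last exact: closed_ge.
by apply: continuous_cabs; exact: cb.
Qed.

Lemma C0_compact b (K : set (unit_space G)) : continuous b -> compact K ->
  (forall u, ~ K u -> b u = 0) -> C0 b.
Proof.
move=> cb kK b0; split=> // e e0; apply: (subclosed_compact _ kK).
  exact: closed_cabs_ge.
move=> u /= eb; apply: contrapT => /b0 bu; move: eb.
by rewrite bu cabs0 leNgt e0.
Qed.

Lemma C0_le b (b' : unit_space G -> R[i]) (c : R) : 0 < c -> continuous b ->
  C0 b' -> (forall u, cabs (b u) <= c * cabs (b' u)) -> C0 b.
Proof.
move=> c0 cb [_ kb'] bb'; split=> // e e0.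
apply: (subclosed_compact _ (kb' (e / c) _)); first exact: closed_cabs_ge.
  by rewrite divr_gt0.
by move=> u /= eb; rewrite ler_pdivrMr// mulrC; exact: le_trans eb (bb' u).
Qed.

Lemma C0M b (b' : unit_space G -> R[i]) : C0 b -> C0 b' ->
  C0 (fun u => b u * b' u).
Proof.
move=> Cb Cb'; have [M M0 bM] := C0_bounded Cb.
apply: (@C0_le _ b' (M + 1)); [by rewrite ltr_wpDl| |exact: Cb'|].
  move=> u; apply: continuous_cM; [have [+ _] := Cb | have [+ _] := Cb']; exact.
move=> u; rewrite cabsM ler_wpM2r ?cabs_ge0//.
by apply: le_trans (bM u) _; rewrite lerDl.
Qed.

Lemma C0_uniform b : (forall e : R, 0 < e ->
  exists b', C0 b' /\ forall u, cabs (b u - b' u) <= e) -> C0 b.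
Proof.
move=> bb'; have cb : continuous b.
  have /choice[F FP] : forall e : R, exists b', 0 < e ->
      C0 b' /\ forall u, cabs (b u - b' u) <= e.
    move=> e; have [e0|e0] := ltP 0 e; last by exists b.
    by have [b' b'P] := bb' e e0; exists b'.
  move=> u; apply: (@continuous_uniform _ _ b F u) => e e0.
    by have [[+ _] _] := FP e e0; exact.
  by have [_ +] := FP e e0; exact.
split=> // e e0; have e20 : 0 < e / 2 by rewrite divr_gt0.
have [b' [[_ kb'] b'e]] := bb' _ e20.
apply: (subclosed_compact _ (kb' _ e20)); first exact: closed_cabs_ge.
move=> u /= eb; have := le_cabsD (b u - b' u) (b' u); rewrite subrK.
by have := b'e u; lra.
Qed.

Lemma transfer_supp p X (k : G -> R[i]) u : Cc_on X k ->
  ~ (p @` csupp k) u -> transfer p X k u = 0.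
Proof.
move=> _ nu; apply: transfer_out => c _ cu; apply: csuppN => kc; apply: nu.
by exists c.
Qed.

(** At the points outside p(X) continuity holds since the image of the support
    of [k] is compact, hence closed. *)
Lemma transfer_C0 p X (k : G -> R[i]) : open X -> continuous p ->
  homeo_onto_open p X -> Cc_on X k -> C0 (transfer p X k).
Proof.
move=> oX cp hX Ck; have [[ck kk] kX] := Ck.
have kp : compact (p @` csupp k).
  by apply: continuous_compact kk; exact: continuous_subspaceT.
apply: (@C0_compact _ (p @` csupp k)) => //; last first.
  by move=> u; exact: transfer_supp.
have [g [gp cg]] := homeo_inverse hX.
move=> u; apply/continuous_cabsP => e e0.
have [[c Xc cu]|nu] := pselect ((p @` X) u).
  have ckg : {for u, continuous (fun v => k (g v))}.
    rewrite -cu; apply: (@continuous_comp _ _ _ g k); first exact: cg.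
    exact: ck.
  have near_u v : (p @` X) v -> transfer p X k v = k (g v).
    move=> [d Xd <-]; rewrite transfer_in// ?gp// => d' Xd'.
    exact: homeo_inj hX _ _.
  have nX : nbhs u (p @` X).
    by apply: open_nbhs_nbhs; split; [case: hX | exists c].
  move/continuous_cabsP : ckg => /(_ e e0); apply: filterS2 nX => v vX.
  by rewrite !near_u//; exists c.
have nK : nbhs u (~` (p @` csupp k)).
  apply: open_nbhs_nbhs; split.
    exact: closed_openC (compact_closed (@unit_hausdorff G) kp).
  by move=> [c /kX Xc cu]; apply: nu; exists c.
apply: filterS nK => v nv; rewrite !transfer_supp ?subrr ?cabs0//.
by move=> [c /kX Xc cu]; apply: nu; exists c.
Qed.

(** The units are open in G, so that a bump function of G can be supported in
    them; [src] inverts the inclusion of the units. *)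
Lemma unit_urysohn (K V : set (unit_space G)) : compact K -> open V ->
  K `<=` V ->
  exists h : unit_space G -> R, [/\ continuous h,
    (forall u, 0 <= h u <= 1), (forall u, K u -> h u = 1),
    (forall u, ~ V u -> h u = 0) &
    C0 (fun u => (h u)%:C : R[i]) /\ Cc (ext0 (fun u => (h u)%:C : R[i]))].
Proof.
move=> kK oV KV.
have kK' : compact (@of_unit G @` K).
  by apply: continuous_compact kK; apply: continuous_subspaceT;
    exact: continuous_of_unit.
pose U := gunits (gpd G) `&` @src G @^-1` V.
have oU : open U.
  apply: openI; first exact: open_units.
  by apply: open_comp => // a _; exact: continuous_src.
have KU : @of_unit G @` K `<=` U.
  move=> _ [u /KV Vu <-]; split; first by apply/gunitsP; rewrite src_unit.
  by rewrite /= src_unit.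
have [H bH [H1 HK]] := urysohn_compact R (@etale_hausdorff G)
  (@etale_locally_compact G) kK' oU KU.
have [[cH kH] HU] := Cc_bump bH; have [cH' H0 kH' HU'] := bH.
have Hout a : ~ U a -> H a = 0.
  move=> nU; apply/eqP; apply: contra_notT nU => Ha; apply: HU'.
  exact: subset_closure.
exists (H \o @of_unit G).
have ch : continuous (H \o @of_unit G).
  by move=> u; apply: continuous_comp; [exact: continuous_of_unit | exact: cH'].
have hE u : (@src G @` csupp (fun a => (H a)%:C : R[i])) u \/ H (of_unit u) = 0.
  have [Hu|] := eqVneq (H (of_unit u)) 0; first by right.
  move=> Hu; left; exists (of_unit u); last by rewrite src_unit.
  by apply: csupp_in; rewrite (fmorph_eq0 (real_complex R)).
split.
- exact: ch.
- by move=> u; rewrite H0 H1.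
- by move=> u Ku; apply: HK; exists u.
- by move=> u nV; apply: Hout => -[_ /=]; rewrite src_unit.
split.
  apply: (@C0_compact _ (@src G @` csupp (fun a => (H a)%:C : R[i]))).
  + by move=> u; apply: (@continuous_realC _ _ (H \o @of_unit G)); exact: ch.
  + by apply: continuous_compact kH; apply: continuous_subspaceT;
    exact: continuous_src.
  + by move=> u nu; case: (hE u) => [//|/= ->].
rewrite (_ : ext0 _ = (fun a => (H a)%:C)); first by split.
apply/funext => a; have [/gunitsP <-|na] := pselect (gunits (gpd G) a).
  by rewrite ext0_unit.
by rewrite ext0_out// Hout// => -[].
Qed.

End UnitSpace.

Section ReducedAlgebra.
Variables (R : realType) (G : etale_groupoid).
Local Notation mul := (gmul (gpd G)).
Local Notation inv := (ginv (gpd G)).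
Local Notation H := (l2 R G).
Implicit Types (f g : G -> R[i]) (x y : H) (X : set G) (S T n : H -> H).
Implicit Types b : unit_space G -> R[i].

Lemma Cred_linear T : Cred T -> linear T.
Proof. by move=> [[]]. Qed.

Lemma Cred_bound T : Cred T -> exists2 M, 0 <= M & opbound T M.
Proof. by move=> [/bounded_opP[_]]. Qed.

Lemma Cred_approx T (e : R) : Cred T -> 0 < e ->
  exists2 f, Cc f & opbound (T - lreg f) e.
Proof.
move=> CT e0; have [f Cf Tf] := CT.2 e e0; exists f => //.
apply: opnorm_opbound Tf; apply: linear_sub; first exact: Cred_linear.
exact: lreg_linear.
Qed.

Lemma Cred_intro T : bounded_op T ->
  (forall e : R, 0 < e -> exists2 f, Cc f & opbound (T - lreg f) e) -> Cred T.
Proof.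
move=> bT Tf; split=> // e e0; have [f Cf Tfe] := Tf e e0; exists f => //.
exact: opbound_opnorm (ltW e0) Tfe.
Qed.

Lemma lreg_bounded f : Cc f -> bounded_op (@lreg R G f).
Proof.
by move=> Cf; apply/bounded_opP; split;
  [exact: lreg_linear | exact: lreg_opbound].
Qed.

Lemma opbound_subxx T (M : R) : 0 <= M -> opbound (T - T) M.
Proof.
by move=> M0 x; rewrite !fctE subrr l2norm0 mulr_ge0// l2norm_ge0.
Qed.

Lemma Cred_lreg f : Cc f -> Cred (@lreg R G f).
Proof.
move=> Cf; apply: Cred_intro (lreg_bounded Cf) _ => e e0; exists f => //.
exact: opbound_subxx (ltW e0).
Qed.

Lemma Cred_adjoint S T : Cred T -> adjoint_to T S -> Cred S.
Proof.
move=> CT TS; apply: Cred_intro.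
  apply/bounded_opP; split; first exact: adjoint_linear TS.
  have [M M0 TM] := Cred_bound CT; exists M => //; exact: adjoint_opbound TS TM.
move=> e e0; have [f Cf Tf] := Cred_approx CT e0.
exists (star f); first exact: Cc_star.
exact: adjoint_opbound (adjoint_sub TS (lreg_adjoint Cf)) Tf.
Qed.

(** The functions (b o s) f approximate T b when the functions f approximate
    T. *)
Lemma Cred_diagr T b : Cred T -> C0 b -> Cred (T \o diag b).
Proof.
move=> CT Cb; have [N N0 bN] := C0_bounded Cb; have dN := diag_opbound N0 bN.
apply: Cred_intro.
  apply/bounded_opP; split.
    by apply: linear_comp; [exact: Cred_linear | exact: diag_linear].
  have [M M0 TM] := Cred_bound CT; exists (M * N); first exact: mulr_ge0.
  exact: opbound_comp.
move=> e e0; have N1 : 0 < N + 1 by rewrite ltr_wpDl.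
have [f Cf Tf] := Cred_approx CT (divr_gt0 e0 N1).
exists (fun c => b (src c) * f c).
  apply: CcM Cf => c; apply: (@continuous_comp _ _ _ (@src G) b).
    exact: continuous_src.
  by have [+ _] := Cb; exact.
rewrite -lreg_diag// => x.
have -> : ((T \o diag b) - (lreg f \o diag b)) x = (T - lreg f)
  (diag b x) by [].
apply: le_trans (Tf _) _.
apply: (@le_trans _ _ (e / (N + 1) * ((N + 1) * l2norm x))).
  apply: ler_wpM2l; first by rewrite ltW// divr_gt0.
  apply: le_trans (dN x) _.
  by rewrite ler_wpM2r ?l2norm_ge0// lerDl.
by rewrite mulrA divfK ?gt_eqF.
Qed.

Lemma Ered_le T (M : R) u : opbound T M -> cabs (Ered T u) <= M.
Proof.
move=> TM; apply: le_trans (le_cabs_l2norm _ _) _.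
by apply: le_trans (TM _) _; rewrite l2norm_delta mulr1.
Qed.

Lemma EredB S T u : Ered (S - T) u = Ered S u - Ered T u.
Proof. by []. Qed.

Lemma Ered_lreg f u : Cc f -> Ered (lreg f) u = f (of_unit u).
Proof. by move=> Cf; apply: Ered_conv => x; apply/funext => a;
  rewrite lregE. Qed.

(** A uniform limit of restrictions of continuous functions. *)
Lemma Ered_continuous T : Cred T -> continuous (Ered T).
Proof.
move=> CT; have /choice[F FP] : forall e : R, exists f, 0 < e ->
    Cc f /\ opbound (T - lreg f) e.
  move=> e; have [e0|e0] := ltP 0 e; last by exists 0.
  by have [f Cf Tf] := Cred_approx CT e0; exists f.
move=> u; apply: (@continuous_uniform _ _ _ (fun e u => F e (of_unit u))) => e
  e0.
  apply: (@continuous_comp _ _ _ (@of_unit G) (F e));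
    first exact: continuous_of_unit.
  by have [[+ _] _] := FP e e0; exact.
move=> v; have [Cf Tf] := FP e e0.
by rewrite -Ered_lreg// -EredB; exact: Ered_le.
Qed.

(** The function is b = E(T): it is a uniform limit of functions in C0(G^(0)),
    and each coordinate of T x - b x is small. *)
Lemma Diag_closed T : linear T -> (forall e : R, 0 < e ->
  exists2 b, C0 b & opbound (T - diag b) e) -> Diag T.
Proof.
move=> lT Tb; pose b := @Ered R G T.
have bb' (e : R) (b' : unit_space G -> R[i]) : C0 b' ->
    opbound (T - diag b') e -> forall u, cabs (b u - b' u) <= e.
  by move=> Cb' Tb' u; rewrite -[b']Ered_diag// /b -EredB; exact: Ered_le.
have Cb : C0 b.
  apply: C0_uniform => e e0; have [b' Cb' Tb'] := Tb e e0.
  by exists b'; split=> //; exact: bb'.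
exists b => //; apply/funext => x; apply: l2_inj => a; rewrite diagE//.
apply/esym/eqP; rewrite -subr_eq0; apply/eqP/cabs_eq0/eqP.
rewrite eq_le cabs_ge0 andbT; apply/ler_addgt0Pr => e e0; rewrite add0r.
have xp : 0 < 2 * (l2norm x + 1) by rewrite mulr_gt0 ?ltr_wpDl ?l2norm_ge0.
have d0 := divr_gt0 e0 xp; have [b' Cb' Tb'] := Tb _ d0.
have -> : T x a - b (rng a) * x a =
    (T x a - diag b' x a) + - ((b (rng a) - b' (rng a)) * x a).
  by rewrite diagE// mulrBl opprB addrA subrK.
apply: le_trans (le_cabsD _ _) _.
have h1 : cabs (T x a - diag b' x a) <= e / (2 * (l2norm x + 1)) * (l2norm x +
  1).
  apply: le_trans (le_trans (le_cabs_l2norm (T x - diag b' x) a) (Tb' x)) _.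
  by rewrite ler_wpM2l ?ltW// ltrDl.
have h2 : cabs (- ((b (rng a) - b' (rng a)) * x a)) <=
    e / (2 * (l2norm x + 1)) * (l2norm x + 1).
  rewrite cabsN cabsM ler_pM ?cabs_ge0//; first exact: bb' Cb' Tb' _.
  by apply: le_trans (le_cabs_l2norm _ _) _; rewrite lerDl.
apply: le_trans (lerD h1 h2) _.
have l0 : l2norm x + 1 != 0 by rewrite gt_eqF// ltr_wpDl ?l2norm_ge0.
by rewrite le_eqVlt; apply/orP; left; apply/eqP; field.
Qed.

End ReducedAlgebra.

(** * Normalizers and the conditional expectation *)

Section Normalizers.
Variables (R : realType) (G : etale_groupoid).
Local Notation mul := (gmul (gpd G)).
Local Notation inv := (ginv (gpd G)).
Local Notation H := (l2 R G).
Implicit Types (f g : G -> R[i]) (x y : H) (X : set G) (S T n : H -> H).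
Implicit Types b : unit_space G -> R[i].

Lemma lreg_conj X f b : bisection X -> Cc_on X f -> C0 b ->
  lreg f \o diag b \o opstar (lreg f) =
  @diag R G (transfer (@rng G) X (fun c => (cabs (f c) ^+ 2)%:C * b (src c))) /\
  C0 (transfer (@rng G) X (fun c => (cabs (f c) ^+ 2)%:C * b (src c))).
Proof.
move=> bX CXf Cb; have [Cf _] := CXf; have [cf _] := Cf; have Csf := Cc_star Cf.
have Ck : Cc_on X (fun c => (cabs (f c) ^+ 2)%:C * b (src c)).
  have -> : (fun c => (cabs (f c) ^+ 2)%:C * b (src c)) =
      (fun c => (b (src c) * (f c)^*%C) * f c) :> (G -> R[i]).
    by apply/funext => c; rewrite -mul_conjC; ring.
  apply: (@Cc_onM _ _ X f (fun c => b (src c) * (f c)^*%C)) CXf => c.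
  apply: (@continuous_cM _ _ (fun c => b (src c)) (fun c => (f c)^*%C));
    last by apply: continuous_conj; exact: cf.
  apply: (@continuous_comp _ _ _ (@src G) b); first exact: continuous_src.
  by have [+ _] := Cb; exact.
have Ct : C0 (transfer (@rng G) X (fun c => (cabs (f c) ^+ 2)%:C * b (src c))).
  have [oX _ hX] := bX; apply: transfer_C0 => //; exact: continuous_rng.
split=> //; rewrite opstar_lreg//; apply/funext => x; apply: l2_inj => a.
rewrite (diagE _ _ Ct) [LHS](lregE _ _ Cf) -(conv_conj b _ _ bX CXf).
rewrite !convE /transfer; apply: eq_fsbigr => c _.
by rewrite (diagE _ _ Cb) (lregE _ _ Csf).
Qed.

Lemma lreg_normalizer X f : bisection X -> Cc_on X f ->
  normalizer (@lreg R G f).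
Proof.
move=> bX CXf; have [Cf _] := CXf; split; first exact: Cred_lreg.
move=> _ [b Cb <-]; split.
  by have [-> Ct] := lreg_conj bX CXf Cb; eexists; [exact: Ct|].
have [E Ct] := lreg_conj (bisection_inv bX) (Cc_on_star CXf) Cb.
by move: E; rewrite !opstar_lreg ?starK//; [move=> ->; eexists;
  [exact: Ct|] | exact: Cc_star].
Qed.

(** An approximate unit e of C0(G^(0)) satisfies e n -> n in norm, and
    n^* e n b lies in C0(G^(0)), which is closed. *)
Lemma normalizer_square n S b : normalizer n -> adjoint_to n S -> C0 b ->
  Diag (S \o n \o diag b).
Proof.
move=> [Cn nD] nS Cb; have CS := Cred_adjoint Cn nS.
have [N N0 bN] := C0_bounded Cb; have dN := diag_opbound N0 bN.
have [M M0 SM] := Cred_bound CS.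
have lS := Cred_linear CS; have ln := Cred_linear Cn.
apply: Diag_closed.
  by apply: linear_comp; [exact: linear_comp | exact: diag_linear].
move=> e e0; have MN : 0 < M * (2 * (N + 1)) + 1.
  by rewrite ltr_wpDl// !mulr_ge0// addr_ge0.
(* |n^* (n - e n) b| <= M (2 d) N, and M (2 d) N <= e for this d; the summand 1
   keeps the denominator positive. *)
have d0 := divr_gt0 e0 MN; set d := e / _ in d0.
have [f Cf nf] := Cred_approx Cn d0.
have kr : compact (@rng G @` csupp f).
  apply: continuous_compact; last by case: Cf.
  by apply: continuous_subspaceT; exact: continuous_rng.
have [h [ch h01 hK _ [Ch _]]] := unit_urysohn R kr openT (@subsetT _ _).
pose u v := (h v)%:C : R[i].
have uf : diag u \o lreg f = lreg f.
  rewrite diag_lreg//; congr lreg; apply/funext => c.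
  have [fc|/csuppN ->] := pselect (csupp f c); last by rewrite mulr0.
  by rewrite /u hK ?mul1r//; exists c.
have u1 : opbound (@diag R G u) 1.
  apply: diag_opbound => // v; have /andP[h0 h1] := h01 v.
  by rewrite cabs_real ger0_norm.
have [_ [b1 Cb1 b1E]] := nD _ (ex_intro2 _ _ u Ch erefl).
rewrite (opstarE nS) in b1E.
have Cbb := C0M Cb1 Cb.
exists (fun v => b1 v * b v) => // x.
have E : diag (fun v => b1 v * b v) x = S (diag u (n (diag b x))).
  transitivity (diag b1 (diag b x)); last by rewrite b1E.
  by apply: l2_inj => a; rewrite !diagE// mulrA.
set y := diag b x in E *.
change (l2norm (S (n y) - diag (fun v => b1 v * b v) x) <= e * l2norm x).
rewrite E -linear_funB//; apply: le_trans (SM _) _.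
have -> : n y - diag u (n y) = (n y - lreg f y) - diag u (n y - lreg f y).
  rewrite (linear_funB _ _ (diag_linear Ch)).
  have -> : diag u (lreg f y) = lreg f y by rewrite -[in RHS]uf.
  by rewrite opprB addrA subrK.
have ny : l2norm (n y - lreg f y) <= d * l2norm y := nf y.
have yx : l2norm y <= N * l2norm x := dN x.
have uny : l2norm (diag u (n y - lreg f y)) <= d * l2norm y.
  by apply: le_trans (u1 _) _; rewrite mul1r.
apply: (@le_trans _ _ (M * (2 * (d * (N * l2norm x))))).
  apply: ler_wpM2l => //; apply: le_trans (l2normD _ _) _; rewrite l2normN.
  have dy := ler_wpM2l (ltW d0) yx; rewrite mulr_natl mulr2n; apply: lerD.
    exact: le_trans ny dy.
  exact: le_trans uny dy.
have x0 := l2norm_ge0 x.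
have eE : e = d * (M * (2 * (N + 1)) + 1) by rewrite /d divfK ?gt_eqF.
rewrite [in leRHS]eE -subr_ge0.
have -> : d * (M * (2 * (N + 1)) + 1) * l2norm x - M * (2 * (d * (N * l2norm
  x))) =
    d * l2norm x * (2 * M + 1) by ring.
have M1 : 0 <= 2 * M + 1 by rewrite addr_ge0// mulr_ge0.
by rewrite mulr_ge0// mulr_ge0// ltW.
Qed.

(** The factorizations of the unit u are u = c c^-1 with c of range u; here c
    must lie in [X]. *)
Lemma Ered_mull X f g : bisection X -> Cc_on X f -> Cc g ->
  Ered (lreg f \o @lreg R G g) = transfer (@rng G) X (fun c => f c * g (inv c)).
Proof.
move=> bX CXf Cg; have [Cf _] := CXf; apply/funext => u.
rewrite /Ered /comp (lregE _ _ Cf).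
have fX c : ~ X c -> f c = 0 by exact: Cc_on_out CXf.
have [[c [Xc cu]]|noc] := pselect (exists c, X c /\ rng c = u); last first.
  rewrite conv_out => [|c].
    by rewrite transfer_out// => c Xc cu; exfalso; apply: noc; exists c.
  by rewrite rng_unit => cu; apply: fX => Xc; apply: noc; exists c.
rewrite -cu transfer_in//; last by move=> d Xd; apply: (rng_inj bX).
rewrite (@conv_in _ _ _ _ X _ c)//; first last.
- by rewrite rng_unit.
- by move=> ? ?; exact: rng_inj.
congr (_ * _); rewrite -[in mul _ _]srcV mulu1 lregE// conv_delta.
by rewrite srcV eqxx.
Qed.

(** Here u = d d^-1 and it is c = d^-1, of source u, that must lie in [X]. *)
Lemma Ered_mulr X f g : bisection X -> Cc_on X f -> Cc g ->
  Ered (lreg g \o @lreg R G f) = transfer (@src G) X (fun c => f c * g (inv c)).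
Proof.
move=> bX CXf Cg; have [Cf _] := CXf; apply/funext => u.
rewrite /Ered /comp (lregE _ _ Cg).
have fX c : ~ X c -> f c = 0 by exact: Cc_on_out CXf.
rewrite convE rng_unit /transfer setTI.
transitivity (\sum_(d \in @rng G @^-1` [set u]) g d * f (inv d)).
  apply: eq_fsbigr => d /set_mem /= <-.
  by rewrite -[in mul _ _]srcV mulu1 lregE// conv_delta srcV eqxx.
have [[c [Xc cu]]|noc] := pselect (exists c, X c /\ src c = u); last first.
  rewrite fsbig1; last first.
    move=> d /= du; rewrite fX ?mulr0// => Xd; apply: noc; exists (inv d).
    by rewrite srcV.
  by rewrite -/(transfer _ _ _ _) transfer_out// => c Xc cu; exfalso;
    apply: noc; exists c.
rewrite -/(transfer (@src G) X _ u) -cu transfer_in//; last first.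
  by move=> d Xd; apply: (src_inj bX).
rewrite -(fsbig_widen [set inv c]) ?fsbig_set1.
- by rewrite invK mulrC.
- by move=> _ ->; rewrite /= rngV.
- move=> d [/= du nd]; apply/eqP; rewrite mulf_eq0; apply/orP; right; apply/eqP.
  apply: fX => Xd; apply: nd; rewrite -(invK d); congr inv.
  by apply: (src_inj bX) => //; rewrite srcV.
Qed.

End Normalizers.

(** * Integration over the unit space *)

Section Integration.
Variables (R : realType) (G : etale_groupoid).
Variable mu : probability (unit_space G) R.
Local Notation U0 := (unit_space G).
Implicit Types (b : U0 -> R[i]) (h : U0 -> R).

Lemma measurable_open (V : set U0) : open V -> measurable V.
Proof. by move=> oV; exact: sub_sigma_algebra. Qed.

Lemma measurable_compact (K : set U0) : compact K -> measurable K.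
Proof.
move=> cK; rewrite -(setCK K); apply: measurableC; apply: measurable_open.
exact: closed_openC (compact_closed (@unit_hausdorff G) cK).
Qed.

Lemma measurable_continuous h : continuous h -> measurable_fun setT h.
Proof.
move=> ch; apply: (measurability _ (RGenOpens.measurableE R)).
move=> _ [_ [a [c ->] <-]]; rewrite setTI; apply: measurable_open.
by apply: open_comp => [u _|]; [exact: ch | exact: interval_open].
Qed.

Lemma integrable_bounded h (M : R) : measurable_fun setT h ->
  (forall u, `|h u| <= M) -> mu.-integrable setT (EFin \o h).
Proof.
move=> mh hM; apply: measurable_bounded_integrable => //.
  by rewrite (le_lt_trans (probability_le1 mu measurableT))// ltry.
exists M; split; first exact: num_real.
by move=> N MN u _ /=; exact: le_trans (hM u) (ltW MN).
Qed.

Definition bounded_continuous b :=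
  continuous b /\ exists M : R, forall u, cabs (b u) <= M.

Lemma C0_bounded_continuous b : C0 b -> bounded_continuous b.
Proof.
move=> Cb; split; first by case: Cb.
by have [M _ bM] := C0_bounded Cb; exists M.
Qed.

Lemma integrable_Re b : bounded_continuous b ->
  mu.-integrable setT (EFin \o (fun u => complex.Re (b u))).
Proof.
move=> [cb [M bM]]; apply: (@integrable_bounded _ M) => [|u].
  by apply: measurable_continuous => u; have /continuous_ReIm[] := cb u.
exact: le_trans (le_Re_cabs _) (bM u).
Qed.

Lemma integrable_Im b : bounded_continuous b ->
  mu.-integrable setT (EFin \o (fun u => complex.Im (b u))).
Proof.
move=> [cb [M bM]]; apply: (@integrable_bounded _ M) => [|u].
  by apply: measurable_continuous => u; have /continuous_ReIm[] := cb u.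
exact: le_trans (le_Im_cabs _) (bM u).
Qed.

Lemma integrableZ_EFin (c : R) h : mu.-integrable setT (EFin \o h) ->
  mu.-integrable setT (EFin \o (fun u => c * h u)).
Proof.
move=> ih; have := integrableZl measurableT c ih.
by apply: eq_integrable => // u _; rewrite /= EFinM.
Qed.

Lemma phi_ofD b (b' : U0 -> R[i]) : bounded_continuous b ->
  bounded_continuous b' ->
  phi_of mu (fun u => b u + b' u) = phi_of mu b + phi_of mu b'.
Proof.
move=> Bb Bb'; apply/eqP; rewrite eq_complex /=.
have -> : (fun u => complex.Re (b u + b' u)) =
    (fun u => complex.Re (b u) + complex.Re (b' u)).
  by apply/funext => u; rewrite Re_add.
have -> : (fun u => complex.Im (b u + b' u)) =
    (fun u => complex.Im (b u) + complex.Im (b' u)).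
  by apply/funext => u; rewrite Im_add.
by rewrite !RintegralD ?eqxx //;
  first [exact: integrable_Re | exact: integrable_Im].
Qed.

Lemma phi_ofZ (c : R[i]) b : bounded_continuous b ->
  phi_of mu (fun u => c * b u) = c * phi_of mu b.
Proof.
move=> Bb; have iR := integrable_Re Bb; have iI := integrable_Im Bb.
case: c => x y; apply/eqP; rewrite eq_complex /=.
have -> : (fun u => complex.Re ((x +i* y)%C * b u)) =
    (fun u => x * complex.Re (b u) + (- y) * complex.Im (b u)).
  by apply/funext => u; case: (b u) => p q /=; rewrite mulNr.
have -> : (fun u => complex.Im ((x +i* y)%C * b u)) =
    (fun u => x * complex.Im (b u) + y * complex.Re (b u)).
  by apply/funext => u; case: (b u) => p q /=.
rewrite !RintegralD //; try exact: integrableZ_EFin.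
by rewrite !RintegralZl// mulNr !eqxx.
Qed.

Lemma bounded_continuousZ (c : R[i]) b :
  bounded_continuous b -> bounded_continuous (fun u => c * b u).
Proof.
move=> [cb [M bM]]; split.
  move=> u; apply: (@continuous_cM _ _ (fun=> c) b); last exact: cb.
  exact: cst_continuous.
by exists (cabs c * M) => u; rewrite cabsM ler_wpM2l ?cabs_ge0.
Qed.

Lemma bounded_continuousD b (b' : U0 -> R[i]) : bounded_continuous b ->
  bounded_continuous b' -> bounded_continuous (fun u => b u + b' u).
Proof.
move=> [cb [M bM]] [cb' [M' bM']]; split.
  by move=> u; apply: continuous_cD; [exact: cb | exact: cb'].
by exists (M + M') => u; apply: le_trans (le_cabsD _ _) _; exact: lerD.
Qed.

Lemma Rintegral_le_cst h (M : R) : mu.-integrable setT (EFin \o h) ->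
  (forall u, h u <= M) -> Rintegral mu setT h <= M.
Proof.
move=> ih hM.
have -> : M = Rintegral mu setT (cst M).
  rewrite Rintegral_cst//.
  by have -> : fine (mu setT) = 1;
    [rewrite (probability_setT mu) | rewrite mulr1].
apply: le_Rintegral => //.
by apply: (@integrable_bounded _ `|M|) => //; exact: measurable_cst.
Qed.

(** The modulus of z = phi(b) satisfies |z|^2 = Re phi(z^* b). *)
Lemma cabs_phi_of b (M : R) : bounded_continuous b ->
  (forall u, cabs (b u) <= M) -> cabs (phi_of mu b) <= M.
Proof.
move=> Bb bM; set z := phi_of mu b.
have [z0|z0] := eqVneq (cabs z) 0.
  rewrite z0; apply: le_trans (bM point); exact: cabs_ge0.
have zp : 0 < cabs z by rewrite lt_neqAle eq_sym z0 cabs_ge0.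
rewrite -(ler_pM2l zp) -expr2.
have -> : cabs z ^+ 2 = complex.Re (phi_of mu (fun u => z^*%C * b u)).
  by rewrite phi_ofZ// mulrC mul_conjC.
apply: Rintegral_le_cst.
  exact/integrable_Re/bounded_continuousZ.
move=> u; apply: le_trans (ler_norm _) _; apply: le_trans (le_Re_cabs _) _.
by rewrite cabsM cabs_conj ler_wpM2l ?cabs_ge0.
Qed.

Lemma phi_of_real h : phi_of mu (fun u => (h u)%:C) = (Rintegral mu setT h)%:C.
Proof.
apply/eqP; rewrite eq_complex /= eqxx /=; apply/eqP.
by rewrite Rintegral_cst// mul0r.
Qed.

Lemma measure_le_Rintegral h (K : set U0) : measurable K ->
  mu.-integrable setT (EFin \o h) -> (forall u, 0 <= h u) ->
  (forall u, K u -> 1 <= h u) -> (mu K <= (Rintegral mu setT h)%:E)%E.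
Proof.
move=> mK ih h0 hK; have mh := measurable_int mu ih.
rewrite /Rintegral fineK; last exact: integrable_fin_num.
rewrite -(setIT K) -integral_indic//; apply: ge0_le_integral => //.
  by apply/measurable_EFinP; exact: measurable_indic.
move=> u _; rewrite lee_fin indicE.
have [Ku|nKu] := pselect (K u).
  by rewrite (mem_set Ku); exact: hK.
by rewrite (memNset nKu); exact: h0.
Qed.

Lemma Rintegral_le_measure h (V : set U0) : measurable V ->
  mu.-integrable setT (EFin \o h) -> (forall u, 0 <= h u <= 1) ->
  (forall u, ~ V u -> h u = 0) -> ((Rintegral mu setT h)%:E <= mu V)%E.
Proof.
move=> mV ih h01 hV; have mh := measurable_int mu ih.
rewrite /Rintegral fineK; last exact: integrable_fin_num.
rewrite -[in leRHS](setIT V) -integral_indic//; apply: ge0_le_integral => //.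
- by move=> u _; rewrite lee_fin; have /andP[] := h01 u.
- by apply/measurable_EFinP; exact: measurable_indic.
move=> u _; rewrite lee_fin indicE; have /andP[h0 h1] := h01 u.
have [Vu|nVu] := pselect (V u); first by rewrite (mem_set Vu).
by rewrite (memNset nVu) hV.
Qed.

(** Both integrals are the mean of the common distribution on the real line. *)
Lemma equidistributed_Rintegral (h k : U0 -> R) (M : R) :
  measurable_fun setT h -> measurable_fun setT k ->
  (forall u, `|h u| <= M) -> (forall u, `|k u| <= M) ->
  (forall A : set R, measurable A -> mu (h @^-1` A) = mu (k @^-1` A)) ->
  Rintegral mu setT h = Rintegral mu setT k.
Proof.
move=> mh mk hM kM hk.
have dist (l : U0 -> R) (ml : measurable_fun setT l) :
  (forall u, `|l u| <= M) ->
    exists X : {RV mu >-> R}, (X = l :> (U0 -> R)) /\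
      (\int[mu]_u (l u)%:E = \int[distribution mu X]_y y%:E)%E.
  move=> lM; pose X : {RV mu >-> R} :=
    HB.pack l (isMeasurableFun.Build _ _ _ _ l ml).
  exists X; split=> //; apply/esym;
    apply: (integral_distribution (X := X) (f := EFin)).
    exact: EFin_measurable.
  exact: (@integrable_bounded l M).
rewrite /Rintegral; have [X [Xh ->]] := dist _ mh hM;
  have [Y [Yk ->]] := dist _ mk kM.
congr fine; apply: eq_measure_integral => A mA _.
change (mu (X @^-1` A) = mu (Y @^-1` A)).
by rewrite Xh Yk; exact: hk.
Qed.

End Integration.

(** * Balanced measures and traces *)

Section Transport.
Variables (R : realType) (G : etale_groupoid).
Local Notation mul := (gmul (gpd G)).
Local Notation inv := (ginv (gpd G)).
Local Notation U0 := (unit_space G).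
Implicit Types (X : set G) (p q : G -> U0).

(** In a product c u d^-1 of arrows c, d of [X], both sources are equal to u, so
    that c = d. *)
Lemma gconjE X (B : set U0) : bisection X ->
  gconj X B = @rng G @` [set c | X c /\ B (src c)].
Proof.
move=> bX; apply/seteqP; split=> [v|_ [c [Xc Bc] <-]].
  move=> [[c' d'] [/= /compP cd [[[c u'] [/= /compP cu [Xc [u Bu /= eu]]] /= ec]
    [d Xd /= ed]]] /= e].
  have {}cu : src c = u by rewrite cu -eu rng_unit.
  have {}ec : c' = c by rewrite -ec -eu -cu mulu1.
  move: cd e; rewrite ec -ed rngV => cd e.
  have E := src_inj bX Xc Xd cd.
  exists c; first by rewrite /= cu.
  by apply: (@unit_inj G); rewrite -e -E -of_unit_rng.
exists (mul c (of_unit (src c)), inv c); last by rewrite /= mulu1.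
split; first by apply/compP; rewrite /= mulu1 rngV.
split; last by exists c.
exists (c, of_unit (src c)) => //; split; last by split=> //; exists (src c).
by apply/compP; rewrite rng_unit.
Qed.

Lemma gconj_src X (B : set U0) :
  @src G @` X `&` B = @src G @` [set c | X c /\ B (src c)].
Proof.
apply/seteqP; split=> [u [[c Xc <-] Bc]|_ [c [Xc Bc] <-]]; first by exists c.
by split=> //; exists c.
Qed.

(** The set is the part of p(X) that q o p^-1, a continuous map on the open set
    p(X), sends into [B]. *)
Lemma measurable_transport p q X (B : set U0) : homeo_onto_open p X ->
  continuous q -> measurable B -> measurable (p @` [set c | X c /\ B (q c)]).
Proof.
move=> hX cq mB; have [g [gp cg]] := homeo_inverse hX; have [oX _ _] := hX.
have mg : measurable_fun (p @` X) (q \o g).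
  apply: (measurability (@open U0)) => // _ [V oV <-].
  apply: measurable_open; have : {in p @` X, continuous (q \o g)}.
    move=> _ /set_mem[c Xc <-]; apply: continuous_comp; first exact: cg.
    exact: cq.
  by move/(continuous_inP _ oX); exact.
have -> : p @` [set c | X c /\ B (q c)] = p @` X `&` (q \o g) @^-1` B.
  apply/seteqP; split=> [_ [c [Xc Bc] <-]|_ [[c Xc <-] /=]].
    by split; [exists c | rewrite /= gp].
  by rewrite gp// => Bc; exists c.
by apply: mg => //; exact: measurable_open.
Qed.

Lemma transfer_comp (V W : nmodType) (F : V -> W) p X (k : G -> V) u :
  F 0 = 0 -> homeo_onto_open p X ->
  transfer p X (F \o k) u = F (transfer p X k u).
Proof.
move=> F0 hX; have [[c [Xc <-]]|noc] := pselect (exists c, X c /\ p c = u).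
  by rewrite !transfer_in// => d Xd; exact: homeo_inj hX _ _.
have out (V' : nmodType) (k' : G -> V') : transfer p X k' u = 0.
  by apply: transfer_out => c Xc cu; exfalso; apply: noc; exists c.
by rewrite !out F0.
Qed.

Variable mu : probability U0 R.

(** The set where [transfer p X k] takes values in A is p(D), with D the part of
    [X] where k lies in A, as soon as A avoids 0; being balanced equates the
    measures of s(D) and r(D). A set containing 0 is reduced to its complement. *)
Lemma balanced_distribution X (k : G -> R) (A : set R) :
  bisection X -> balanced mu X ->
  measurable_fun setT (transfer (@src G) X k) ->
  measurable_fun setT (transfer (@rng G) X k) -> measurable A ->
  mu (transfer (@src G) X k @^-1` A) = mu (transfer (@rng G) X k @^-1` A).
Proof.
move=> bX bal ms mr.
have key (A' : set R) : ~ A' 0 -> measurable A' ->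
    mu (transfer (@src G) X k @^-1` A') = mu (transfer (@rng G) X k @^-1` A').
  move=> A0 mA; have E p : homeo_onto_open p X ->
      transfer p X k @^-1` A' = p @` [set c | X c /\ A' (k c)].
    move=> hX; apply/seteqP; split=> [u /= Au|_ [c [Xc Ac] <-]]; last first.
      by rewrite /= transfer_in// => d Xd; exact: homeo_inj hX _ _.
    have [[c [Xc cu]]|noc] := pselect (exists c, X c /\ p c = u).
      exists c => //; split=> //; move: Au; rewrite -cu transfer_in// => d Xd.
      exact: homeo_inj hX _ _.
    exfalso; apply: A0; move: Au; rewrite transfer_out// => c Xc cu.
    by exfalso; apply: noc; exists c.
  have [oX hs hr] := bX; rewrite (E _ hr).
  have mB : measurable (transfer (@src G) X k @^-1` A').
    by rewrite -[X in measurable X]setTI; exact: ms.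
  have F p : p @` [set c | X c /\ (@src G @` [set d | X d /\ A' (k d)])
    (src c)] =
      p @` [set c | X c /\ A' (k c)].
    congr image; apply/seteqP; split=> c /= [Xc].
      by move=> [d [Xd Ad] dc]; rewrite -(src_inj bX Xd Xc dc).
    by move=> Ac; split=> //; exists c.
  by have := bal _ mB; rewrite gconjE// gconj_src (E _ hs) !F => ->.
move=> mA; have [A0|] := pselect (A 0); last by move=> A0; exact: key.
have C (h : U0 -> R) : measurable_fun setT h ->
    mu (h @^-1` A) = (1 - mu (h @^-1` (~` A)))%E.
  move=> mh; have -> : h @^-1` A = ~` (h @^-1` (~` A)).
    by rewrite preimage_setC setCK.
  apply: probability_setC; rewrite -[X in measurable X]setTI.
  by apply: mh => //; exact: measurableC.
by rewrite (C _ ms) (C _ mr) key//; exact: measurableC.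
Qed.

Lemma balanced_transfer X (k : G -> R[i]) : bisection X -> balanced mu X ->
  Cc_on X k ->
  phi_of mu (transfer (@rng G) X k) = phi_of mu (transfer (@src G) X k).
Proof.
move=> bX bal Ck; have [oX hs hr] := bX.
have /C0_bounded_continuous Br := transfer_C0 oX (@continuous_rng G) hr Ck.
have /C0_bounded_continuous Bs := transfer_C0 oX (@continuous_src G) hs Ck.
have [M M0 kM] := bounded_Cc Ck.1.
have tM p u : homeo_onto_open p X -> cabs (transfer p X k u) <= M.
  move=> hX; have [[c [Xc <-]]|noc] := pselect (exists c, X c /\ p c = u).
    by rewrite transfer_in// => d Xd; exact: homeo_inj hX _ _.
  rewrite transfer_out ?cabs0// => c Xc cu; exfalso; apply: noc; by exists c.
have key (F : R[i] -> R) : F 0 = 0 -> (forall z, `|F z| <= cabs z) ->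
    measurable_fun setT (fun u => F (transfer (@rng G) X k u)) ->
    measurable_fun setT (fun u => F (transfer (@src G) X k u)) ->
    Rintegral mu setT (fun u => F (transfer (@rng G) X k u)) =
    Rintegral mu setT (fun u => F (transfer (@src G) X k u)).
  move=> F0 Fle mr ms.
  have Er : (fun u => F (transfer (@rng G) X k u)) =
    transfer (@rng G) X (F \o k).
    by apply/funext => u; rewrite transfer_comp.
  have Es : (fun u => F (transfer (@src G) X k u)) =
    transfer (@src G) X (F \o k).
    by apply/funext => u; rewrite transfer_comp.
  apply: (@equidistributed_Rintegral _ _ _ _ _ M) => // [u|u|A mA].
  - exact: le_trans (Fle _) (tM _ _ hr).
  - exact: le_trans (Fle _) (tM _ _ hs).
  - by rewrite Er Es; rewrite Er in mr; rewrite Es in ms;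
      rewrite balanced_distribution.
apply/eqP; rewrite eq_complex /=; apply/andP; split; apply/eqP;
  apply: key => //.
- exact: le_Re_cabs.
- by have /measurable_int/measurable_EFinP := integrable_Re mu Br.
- by have /measurable_int/measurable_EFinP := integrable_Re mu Bs.
- exact: le_Im_cabs.
- by have /measurable_int/measurable_EFinP := integrable_Im mu Br.
- by have /measurable_int/measurable_EFinP := integrable_Im mu Bs.
Qed.

End Transport.

Section Trace.
Variables (R : realType) (G : etale_groupoid).
Local Notation H := (l2 R G).
Local Notation U0 := (unit_space G).
Variable mu : probability U0 R.
Implicit Types (f g : G -> R[i]) (S T n : H -> H).

Lemma cabs_approx_eq (x y : R[i]) :
  (forall e : R, 0 < e -> exists z, cabs (x - z) <= e /\ cabs (y - z) <= e) ->
  x = y.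
Proof.
move=> xy; apply/eqP; rewrite -subr_eq0; apply/eqP/cabs_eq0/eqP.
rewrite eq_le cabs_ge0 andbT; apply/ler_addgt0Pr => e e0; rewrite add0r.
have e20 : 0 < e / 2 by rewrite divr_gt0.
have [z [xz yz]] := xy _ e20; have -> : x - y = (x - z) + - (y - z) by ring.
by apply: le_trans (le_cabsD _ _) _; rewrite cabsN; lra.
Qed.

Lemma Ered_bounded_continuous T (M : R) : continuous (Ered T) -> opbound T M ->
  bounded_continuous (Ered T).
Proof. by move=> cT TM; split=> //; exists M => u; exact: Ered_le. Qed.

(** Both sides are additive in [f], and for [f] supported in a bisection both
    expectations are transfers of k(c) = f(c) g(c^-1). *)
Lemma lreg_trace : totally_balanced mu -> forall f, Cc f -> forall g, Cc g ->
  [/\ bounded_continuous (Ered (lreg f \o @lreg R G g)),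
      bounded_continuous (Ered (lreg g \o @lreg R G f)) &
      phi_of mu (Ered (lreg f \o @lreg R G g)) =
      phi_of mu (Ered (lreg g \o @lreg R G f))].
Proof.
move=> bal; apply: Cc_ind => [g Cg|f f' Cf Cf' IH IH' g Cg|X f bX CXf g Cg].
- have z : bounded_continuous (0 : U0 -> R[i]).
    by split; [move=> u; exact: cst_continuous | exists 0 => u; rewrite cabs0].
  have E1 : Ered (lreg 0 \o @lreg R G g) = 0 by rewrite lreg0.
  have E2 : Ered (lreg g \o @lreg R G 0) = 0.
    apply/funext => u; rewrite lreg0 /Ered /comp.
    by rewrite (linear_fun0 (lreg_linear Cg)).
  split.
  - exact: (eq_ind_r (@bounded_continuous R G) z E1).
  - exact: (eq_ind_r (@bounded_continuous R G) z E2).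
  - exact: etrans (congr1 (phi_of mu) E1) (esym (congr1 (phi_of mu) E2)).
- have [B1 B2 E] := IH g Cg; have [B1' B2' E'] := IH' g Cg.
  have E1 : Ered (lreg (f + f') \o @lreg R G g) =
      (fun u => Ered (lreg f \o @lreg R G g) u + Ered (lreg f' \o @lreg R G g)
        u).
    by rewrite (lregD Cf Cf').
  have E2 : Ered (lreg g \o @lreg R G (f + f')) =
      (fun u => Ered (lreg g \o @lreg R G f) u + Ered (lreg g \o @lreg R G f')
        u).
    apply/funext => u; rewrite (lregD Cf Cf') /Ered /comp fctE.
    by rewrite (linear_funD _ _ (lreg_linear Cg)).
  have D1 := bounded_continuousD B1 B1'; have D2 := bounded_continuousD B2 B2'.
  split.
  - exact: (eq_ind_r (@bounded_continuous R G) D1 E1).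
  - exact: (eq_ind_r (@bounded_continuous R G) D2 E2).
  - apply: etrans (congr1 (phi_of mu) E1) _.
    apply: etrans (phi_ofD mu B1 B1') _.
    apply: etrans (congr2 +%R E E') _.
    apply: etrans (esym (phi_ofD mu B2 B2')) _.
    exact: (esym (congr1 (phi_of mu) E2)).
have Ck : Cc_on X (fun c => f c * g (ginv (gpd G) c)).
  have -> : (fun c => f c * g (ginv (gpd G) c)) =
      (fun c => g (ginv (gpd G) c) * f c) :> (G -> R[i]).
    by apply/funext => c; rewrite mulrC.
  apply: (@Cc_onM _ _ X f (fun c => g (ginv (gpd G) c))) CXf => c.
  apply: (@continuous_comp _ _ _ (ginv (gpd G)) g); first exact: continuous_inv.
  by have [+ _] := Cg; exact.
have [oX hs hr] := bX.
have E1 := Ered_mull bX CXf Cg; have E2 := Ered_mulr bX CXf Cg.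
have B1 := C0_bounded_continuous (transfer_C0 oX (@continuous_rng G) hr Ck).
have B2 := C0_bounded_continuous (transfer_C0 oX (@continuous_src G) hs Ck).
split.
- exact: (eq_ind_r (@bounded_continuous R G) B1 E1).
- exact: (eq_ind_r (@bounded_continuous R G) B2 E2).
- apply: etrans (congr1 (phi_of mu) E1) _.
  apply: etrans (balanced_transfer bX (bal X bX) Ck) _.
  exact: (esym (congr1 (phi_of mu) E2)).
Qed.

(** From S T - S' T' = S (T - T') + (S - S') T'. *)
Lemma opbound_mul_sub S T S' T' (M N d : R) : 0 <= M -> 0 <= d <= 1 ->
  linear S -> opbound S M -> opbound T N -> opbound (S - S') d ->
  opbound (T - T') d -> linear S' ->
  opbound ((S \o T) - (S' \o T')) (d * (M + N + 1)).
Proof.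
move=> M0 /andP[d0 d1] lS SM TN SS' TT' lS' x.
have x0 := l2norm_ge0 x.
have -> : ((S \o T) - (S' \o T')) x = S ((T - T') x) + (S - S') (T' x).
  change (S (T x) - S' (T' x) = S (T x - T' x) + (S (T' x) - S' (T' x))).
  by rewrite (linear_funB _ _ lS) addrA subrK.
have T'x : l2norm (T' x) <= (N + 1) * l2norm x.
  have -> : T' x = T x - (T - T') x.
    by change (T' x = T x - (T x - T' x)); rewrite opprB addrC subrK.
  apply: le_trans (l2normD _ _) _; rewrite l2normN mulrDl mul1r.
  apply: lerD; first exact: TN.
  by apply: le_trans (TT' x) _; rewrite ler_piMl.
apply: le_trans (l2normD _ _) _.
have h1 : l2norm (S ((T - T') x)) <= M * (d * l2norm x).
  by apply: le_trans (SM _) _; rewrite ler_wpM2l.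
have h2 : l2norm ((S - S') (T' x)) <= d * ((N + 1) * l2norm x).
  by apply: le_trans (SS' _) _; rewrite ler_wpM2l.
apply: le_trans (lerD h1 h2) _.
by rewrite le_eqVlt; apply/orP; left; apply/eqP; ring.
Qed.

Lemma Cred_mul_approx S T (e : R) : Cred S -> Cred T -> 0 < e ->
  exists f g, [/\ Cc f, Cc g,
    opbound ((S \o T) - (lreg f \o lreg g)) e &
    opbound ((T \o S) - (lreg g \o lreg f)) e].
Proof.
move=> CS CT e0; have [M M0 SM] := Cred_bound CS;
  have [N N0 TN] := Cred_bound CT.
have MN : 0 < M + N + 1 by rewrite ltr_wpDl// addr_ge0.
(* [opbound_mul_sub] gives the bound d (M + N + 1), for d at most 1. *)
pose d := Num.min 1 (e / (M + N + 1)).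
have d0 : 0 < d by rewrite lt_min ltr01 divr_gt0.
have d01 : 0 <= d <= 1 by rewrite ltW//= ge_min lexx.
have de : d * (M + N + 1) <= e by rewrite -ler_pdivlMr// ge_min lexx orbT.
have [f Cf Sf] := Cred_approx CS d0; have [g Cg Tg] := Cred_approx CT d0.
have lf := lreg_linear Cf; have lg := lreg_linear Cg.
exists f, g; split=> //; apply: opbound_le de _.
  by apply: opbound_mul_sub => //; exact: Cred_linear.
by rewrite (addrC M); apply: opbound_mul_sub => //; exact: Cred_linear.
Qed.

(** The expectations of ST and TS are uniformly close to those of convolution
    operators, for which [lreg_trace] holds, and phi does not increase the sup
    norm. *)
Lemma Cred_trace S T : totally_balanced mu -> Cred S -> Cred T ->
  phi_of mu (Ered (S \o T)) = phi_of mu (Ered (T \o S)).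
Proof.
move=> bal CS CT.
have [M M0 SM] := Cred_bound CS; have [N N0 TN] := Cred_bound CT.
have cont S' T' : Cred S' -> Cred T' -> continuous (Ered (S' \o T')).
  move=> CS' CT'; have /choice[F FP] : forall e : R, exists fg, 0 < e ->
      [/\ Cc fg.1, Cc fg.2 & opbound ((S' \o T') - (lreg fg.1 \o lreg fg.2)) e].
    move=> e; have [e0|e0] := ltP 0 e; last by exists (0, 0).
    by have [f [g [Cf Cg ST _]]] := Cred_mul_approx CS' CT' e0; exists (f, g).
  move=> u; apply: (@continuous_uniform _ _ _
      (fun e => Ered (lreg (F e).1 \o lreg (F e).2))) => e e0.
    have [Cf Cg _] := FP e e0; have [[+ _] _ _] := lreg_trace bal Cf Cg; exact.
  by move=> v; have [_ _ +] := FP e e0 => ST; rewrite -EredB; exact: Ered_le.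
have B1 := Ered_bounded_continuous (cont _ _ CS CT) (opbound_comp M0 SM TN).
have B2 := Ered_bounded_continuous (cont _ _ CT CS) (opbound_comp N0 TN SM).
apply: cabs_approx_eq => e e0.
have [f [g [Cf Cg ST TS]]] := Cred_mul_approx CS CT e0.
have [C1 C2 E] := lreg_trace bal Cf Cg.
have sub b (b' : U0 -> R[i]) : bounded_continuous b -> bounded_continuous b' ->
    (forall u, cabs (b u - b' u) <= e) ->
    cabs (phi_of mu b - phi_of mu b') <= e.
  move=> Bb Bb' bb'; have Bn := bounded_continuousZ (-1) Bb'.
  have -> : phi_of mu b - phi_of mu b' = phi_of mu (fun u => b u + (-1) * b' u).
    by rewrite (phi_ofD mu Bb Bn) (phi_ofZ mu _ Bb') mulN1r.
  apply: (cabs_phi_of mu (bounded_continuousD Bb Bn)).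
  by move=> u; rewrite mulN1r; exact: bb'.
have h1 := sub _ _ B1 C1 (fun u => Ered_le u ST).
have h2 := sub _ _ B2 C2 (fun u => Ered_le u TS).
exists (phi_of mu (Ered (lreg f \o lreg g))); split; first exact: h1.
exact: (eq_ind_r (fun z => cabs (_ - z) <= e) h2 E).
Qed.

(** With an adjoint this is |T delta_u|^2; without one, [opstar T] is zero. *)
Lemma Ered_opstar_ge0 T u :
  exists2 r : R, 0 <= r & Ered (opstar T \o T) u = r%:C.
Proof.
rewrite /opstar; case: xgetP => [S _ TS|_]; last by exists 0.
exists (l2norm (T (delta R (of_unit u))) ^+ 2); first exact: sqr_ge0.
rewrite /Ered /comp (adjoint_coord TS) l2dotxx.
by apply/eqP; rewrite eq_complex /= oppr0 !eqxx.
Qed.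

(** The norm 1 is approached on the functions that are 1 on a compact set of
    almost full measure. *)
Lemma Cred_state : radon mu -> is_state (@Cred R G) (phi_of mu \o @Ered R G).
Proof.
move=> [_ hmu]; split.
- move=> c S T CS CT /=.
  have [M _ SM] := Cred_bound CS; have [N _ TN] := Cred_bound CT.
  have BS := Ered_bounded_continuous (Ered_continuous CS) SM.
  have BT := Ered_bounded_continuous (Ered_continuous CT) TN.
  rewrite -phi_ofZ// -phi_ofD//; exact: bounded_continuousZ.
- move=> T _ /=; have /choice[r rP] : forall u, exists r : R,
      0 <= r /\ Ered (opstar T \o T) u = r%:C.
    by move=> u; have [r r0 E] := Ered_opstar_ge0 T u; exists r.
  have -> : Ered (opstar T \o T) = (fun u => (r u)%:C).
    by apply/funext => u; have [] := rP u.
  rewrite phi_of_real ler0c; apply: Rintegral_ge0 => u _.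
  by have [] := rP u.
apply/eqP; rewrite eq_le; apply/andP; split.
  apply: ge_ereal_sup => _ [T [CT T1] <-]; rewrite lee_fin /=.
  have T1' := opnorm_opbound (Cred_linear CT) T1.
  apply: cabs_phi_of; last by move=> u; exact: Ered_le.
  exact: Ered_bounded_continuous (Ered_continuous CT) T1'.
apply/lee_subgt0Pr => e e0.
have sup1 : ereal_sup [set mu K | K in [set K | compact K /\ K `<=` setT]] =
  1%E.
  exact: etrans (esym (hmu setT measurableT)) (probability_setT mu).
have lt1 : ((1 - e%:E) < ereal_sup [set mu K | K in [set K | compact K /\ K
  `<=` setT]])%E.
  by rewrite sup1 -EFinB lte_fin ltrBlDr ltrDl.
have [_ [K [kK _] <-] eK] := ereal_sup_gt lt1.
have [h [ch h01 hK _ [Ch Ce]]] := unit_urysohn R kK openT (@subsetT _ _).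
have mh : measurable_fun setT h by exact: measurable_continuous.
have h0 u : 0 <= h u by have /andP[] := h01 u.
have ih : mu.-integrable setT (EFin \o h).
  apply: (@integrable_bounded _ _ mu h 1) => // u.
  by rewrite ger0_norm//; have /andP[] := h01 u.
apply: (@le_trans _ _ (Rintegral mu setT h)%:E).
  apply: le_trans (ltW eK) _; apply: measure_le_Rintegral => //.
    exact: measurable_compact.
  by move=> u /hK ->.
pose u v := (h v)%:C : R[i].
apply: ereal_sup_ubound; exists (diag u).
  split; first exact: Cred_lreg Ce.
  apply: opbound_opnorm => //; apply: diag_opbound => // v.
  by rewrite cabs_real ger0_norm//; have /andP[] := h01 v.
have -> : (phi_of mu \o @Ered R G) (diag u) = (Rintegral mu setT h)%:C.
  exact: etrans (congr1 (phi_of mu) (Ered_diag Ch)) (phi_of_real mu h).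
by rewrite cabs_real ger0_norm//; apply: Rintegral_ge0 => v _; exact: h0.
Qed.

End Trace.

(** * The four conditions *)

Section Invariance.
Variables (R : realType) (G : etale_groupoid).
Local Notation H := (l2 R G).
Local Notation U0 := (unit_space G).
Variable mu : probability U0 R.
Implicit Types (f g : G -> R[i]) (S T n : H -> H) (X : set G).

(** The trace property is applied to n b and n^*. If n had no adjoint, [opstar n]
    would vanish and both sides of the invariance would be the same. *)
Lemma tracial_fully_invariant :
  is_tracial_state (@Cred R G) (phi_of mu \o @Ered R G) ->
  fully_invariant (phi_of mu).
Proof.
move=> [_ tr] n nn b Cb; have [Cn nD] := nn; have ln := Cred_linear Cn.
rewrite {1 2}/opstar; case: xgetP => [S _ nS|_]; last first.
  congr (phi_of mu (undiag _)); apply/funext => x /=.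
  by rewrite (linear_fun0 (diag_linear Cb)) (linear_fun0 ln).
have CS := Cred_adjoint Cn nS.
have D1 : Diag (n \o diag b \o S).
  by have [+ _] := nD _ (ex_intro2 _ _ b Cb erefl); rewrite (opstarE nS).
have D2 := normalizer_square nn nS Cb.
apply: etrans (congr1 (phi_of mu) (undiag_Ered D1)) _.
apply: etrans (tr _ _ (Cred_diagr Cn Cb) CS) _.
exact: esym (congr1 (phi_of mu) (undiag_Ered D2)).
Qed.

Lemma fully_elementary_invariant :
  @fully_invariant R G (phi_of mu) -> elementary_invariant (phi_of mu).
Proof. by move=> inv X f bX CXf; apply: inv; exact: lreg_normalizer CXf. Qed.

Lemma balanced_tracial : radon mu -> totally_balanced mu ->
  is_tracial_state (@Cred R G) (phi_of mu \o @Ered R G).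
Proof.
move=> hmu bal; split; first exact: Cred_state.
by move=> S T CS CT; exact: Cred_trace.
Qed.

Lemma transfer_gsetinv X (k : G -> R[i]) u : bisection X ->
  transfer (@rng G) (gsetinv (gpd G) X) k u =
  transfer (@src G) X (fun c => k (ginv (gpd G) c)) u.
Proof.
move=> bX; have [[c [Xc <-]]|noc] := pselect (exists c, X c /\ src c = u).
  rewrite [RHS]transfer_in//; last by move=> d Xd; apply: (src_inj bX).
  rewrite -rngV transfer_in//; last by apply/gsetinvE; rewrite invK.
  move=> d Xd; apply: (rng_inj (bisection_inv bX)) => //.
  by apply/gsetinvE; rewrite invK.
rewrite !transfer_out// => c.
  by move=> Xc cu; exfalso; apply: noc; exists c.
by move=> /gsetinvE Xc cu; exfalso; apply: noc; exists (ginv (gpd G) c);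
  rewrite srcV.
Qed.

(** Invariance under f, tested on functions equal to 1 on the source and on the
    range of the support of f. *)
Lemma elementary_transfer X f : elementary_invariant (phi_of mu) ->
  bisection X -> Cc_on X f ->
  phi_of mu (transfer (@rng G) X (fun c => (cabs (f c) ^+ 2)%:C)) =
  phi_of mu (transfer (@src G) X (fun c => (cabs (f c) ^+ 2)%:C)).
Proof.
move=> ei bX CXf; have [Cf _] := CXf; have Csf := Cc_star Cf.
have unit_on p : continuous p -> exists b : U0 -> R[i], C0 b /\
    forall c, f c != 0 -> b (p c) = 1.
  move=> cp; have kp : compact (p @` csupp f).
    apply: continuous_compact; last by case: Cf.
    exact: continuous_subspaceT.
  have [h [_ _ hK _ [Ch _]]] := unit_urysohn R kp openT (@subsetT _ _).
  exists (fun u => (h u)%:C); split=> // c /csupp_in fc.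
  by rewrite hK//; exists c.
have [b [Cb b1]] := unit_on _ (@continuous_src G).
have [b' [Cb' b1']] := unit_on _ (@continuous_rng G).
have [E1 C1] := lreg_conj bX CXf Cb.
have [E2 C2] := lreg_conj (bisection_inv bX) (Cc_on_star CXf) Cb'.
have F1 : lreg f \o diag b = @lreg R G f.
  rewrite (lreg_diag Cf Cb); congr lreg; apply/funext => c.
  by have [->|/b1 ->] := eqVneq (f c) 0; rewrite ?mulr0 ?mul1r.
have F2 : diag b' \o lreg f = @lreg R G f.
  rewrite (diag_lreg Cf Cb'); congr lreg; apply/funext => c.
  by have [->|/b1' ->] := eqVneq (f c) 0; rewrite ?mulr0 ?mul1r.
have E3 : opstar (lreg f) \o lreg f \o diag b =
    lreg (star f) \o diag b' \o opstar (@lreg R G (star f)).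
  have -> : opstar (lreg (star f)) = @lreg R G f.
    by apply: etrans (opstar_lreg Csf) _; rewrite starK.
  have -> : opstar (lreg f) = @lreg R G (star f) by exact: opstar_lreg.
  change (lreg (star f) \o (lreg f \o diag b) =
    lreg (star f) \o (diag b' \o lreg f)).
  by rewrite F1 F2.
have sq1 (a z : R[i]) : (a != 0 -> z = 1) ->
    (cabs a ^+ 2)%:C * z = (cabs a ^+ 2)%:C.
  have [->|a0 ->//] := eqVneq a 0; last by rewrite mulr1.
  by rewrite cabs0 expr0n mul0r.
have T1 : transfer (@rng G) X (fun c => (cabs (f c) ^+ 2)%:C) =
    undiag (lreg f \o diag b \o opstar (lreg f)).
  apply: etrans (esym (etrans (congr1 (@undiag R G) E1) (undiagK C1))).
  by congr transfer; apply/funext => c; rewrite sq1//; exact: b1.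
have T2 : transfer (@src G) X (fun c => (cabs (f c) ^+ 2)%:C) =
    undiag (opstar (lreg f) \o lreg f \o diag b).
  apply: etrans (esym (etrans (congr1 (@undiag R G) (etrans E3 E2))
    (undiagK C2))).
  apply/funext => u; rewrite transfer_gsetinv//; congr (transfer _ _ _ _).
  apply/funext => c; rewrite /star invK cabs_conj srcV sq1//; exact: b1'.
apply: etrans (congr1 (phi_of mu) T1) _.
apply: etrans (ei X f bX CXf b Cb) _.
exact: esym (congr1 (phi_of mu) T2).
Qed.

(** Inner regularity of the complement; [mu] is finite. *)
Lemma outer_regular (K : set U0) (e : R) : radon mu -> measurable K -> 0 < e ->
  exists V, [/\ open V, K `<=` V & (mu V <= mu K + e%:E)%E].
Proof.
move=> [_ hmu] mK e0; have mKc := measurableC mK.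
have fK : mu (~` K) \is a fin_num by rewrite fin_num_measure.
have lt : (mu (~` K) - e%:E < ereal_sup [set mu L | L in [set L | compact L /\
  L `<=` ~` K]])%E.
  by rewrite -hmu// lteBlDr// lteDl// lte_fin.
have [_ [L [cL LK] <-] eL] := ereal_sup_gt lt.
exists (~` L); split.
- exact: closed_openC (compact_closed (@unit_hausdorff G) cL).
- by move=> u Ku Lu; exact: LK Lu Ku.
have mL := measurable_compact cL.
have [r rE] : exists r : R, mu K = r%:E.
  by exists (fine (mu K)); rewrite fineK// fin_num_measure.
have [s sE] : exists s : R, mu L = s%:E.
  by exists (fine (mu L)); rewrite fineK// fin_num_measure.
move: eL; rewrite !probability_setC// rE sE -!EFinD lte_fin lee_fin; lra.
Qed.

(** A bump h in [X] that is 1 on [C] and vanishes off q^-1(V), where V is an open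
    set of measure close to that of q(C), gives
    mu(p(C)) <= int (h^2 on p(X)) = int (h^2 on q(X)) <= mu(V). *)
Lemma elementary_compact_le X p q (C : set G) : radon mu -> bisection X ->
  homeo_onto_open p X -> homeo_onto_open q X -> continuous p -> continuous q ->
  (forall f, Cc_on X f -> phi_of mu (transfer p X (fun c => (cabs (f c) ^+
    2)%:C)) =
                          phi_of mu (transfer q X (fun c => (cabs (f c) ^+
                            2)%:C))) ->
  compact C -> C `<=` X -> (mu (p @` C) <= mu (q @` C))%E.
Proof.
move=> hmu bX hp hq cp cq pq cC CX; have [oX _ _] := bX.
have comp_im (r : G -> U0) : continuous r -> compact (r @` C).
  by move=> cr; apply: continuous_compact cC; exact: continuous_subspaceT.
apply/lee_addgt0Pr => e e0.
have [V [oV CV Ve]] := outer_regular hmu (measurable_compact (comp_im _ cq)) e0.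
apply: le_trans Ve.
have oXV : open (X `&` q @^-1` V).
  by apply: openI => //; apply: open_comp => // c _; exact: cq.
have CXV : C `<=` X `&` q @^-1` V.
  by move=> c Cc; split; [exact: CX | apply: CV; exists c].
have [h bh [h1 hC]] := urysohn_compact R (@etale_hausdorff G)
  (@etale_locally_compact G) cC oXV CXV.
have [ch h0 _ hXV] := bh.
have CXh : Cc_on X (fun c => (h c)%:C : R[i]).
  by have [Ch sh] := Cc_bump bh; split=> // c /sh[].
(* Elementary invariance sees h through |h|^2. *)
have h01 c : 0 <= h c ^+ 2 <= 1 by rewrite sqr_ge0 exprn_ile1.
pose k c := (cabs ((h c)%:C : R[i]) ^+ 2)%:C : R[i].
have kE : k = real_complex R \o (fun c => h c ^+ 2).
  by apply/funext => c; rewrite /k cabs_real ger0_norm.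
have Ck : Cc_on X k.
  have -> : k = (fun c => (h c)%:C * (h c)%:C).
    by apply/funext => c; rewrite kE /= -rmorphM.
  by apply: Cc_onM => // c; apply: continuous_realC; exact: ch.
pose t (r : G -> U0) := transfer r X (fun c => h c ^+ 2).
have tk r u : homeo_onto_open r X -> transfer r X k u = (t r u)%:C.
  by move=> hr; rewrite kE transfer_comp.
have t01 r u : homeo_onto_open r X -> 0 <= t r u <= 1.
  move=> hr; rewrite /t; have [[c [Xc <-]]|noc] :=
    pselect (exists c, X c /\ r c = u).
    by rewrite transfer_in// => d Xd; exact: homeo_inj hr _ _.
  rewrite transfer_out ?lexx ?ler01// => c Xc cu; exfalso; apply: noc;
    by exists c.
have it r : homeo_onto_open r X -> continuous r ->
  mu.-integrable setT (EFin \o t r).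
  move=> hr cr; have /C0_bounded_continuous := transfer_C0 oX cr hr Ck.
  move=> /(integrable_Re mu); apply: eq_integrable => // u _.
  by rewrite /= tk.
have : Rintegral mu setT (t p) = Rintegral mu setT (t q).
  have [] := pq _ CXh; rewrite -/k; move=> + _; rewrite /=.
  under [X in Rintegral _ _ X = _]eq_fun do rewrite tk//.
  by under [X in _ = Rintegral _ _ X]eq_fun do rewrite tk//.
move=> pqE; apply: (@le_trans _ _ (Rintegral mu setT (t p))%:E).
  apply: measure_le_Rintegral.
  - exact: measurable_compact (comp_im _ cp).
  - exact: it.
  - by move=> u; have /andP[] := t01 p u hp.
  - move=> _ [c Cc <-]; rewrite /t transfer_in.
    + by rewrite hC// expr1n.
    + by move=> d Xd e'; apply: (homeo_inj hp) => //; exact: CX.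
    + exact: CX.
rewrite pqE; apply: Rintegral_le_measure.
- exact: measurable_open.
- exact: it.
- by move=> u; exact: t01.
- move=> u nV; apply: transfer_out => c Xc cu; apply/eqP; rewrite sqrf_eq0.
  apply: contra_notT nV => hc; rewrite -cu.
  by have [] : (X `&` q @^-1` V) c by apply/hXV/subset_closure.
Qed.

(** The compact subsets of p(D) are the p(C) with C a compact subset of D. *)
Lemma regular_le X p q (D : set G) : radon mu -> bisection X ->
  homeo_onto_open p X -> continuous q ->
  (forall C, compact C -> C `<=` X -> (mu (p @` C) <= mu (q @` C))%E) ->
  D `<=` X -> measurable (p @` D) -> measurable (q @` D) ->
  (mu (p @` D) <= mu (q @` D))%E.
Proof.
move=> [_ hmu] bX hp cq le DX mp mq; rewrite hmu//.
apply: ge_ereal_sup => _ [K [cK KD] <-].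
have [g [gp cg]] := homeo_inverse hp.
have KX u : K u -> exists c, [/\ D c, X c & p c = u].
  by move=> /KD[c Dc <-]; exists c; split=> //; exact: DX.
have cC : compact (g @` K).
  apply: continuous_compact cK;
    apply: continuous_in_subspaceT => u /set_mem /KX.
  by move=> [c [_ Xc <-]]; exact: cg.
have pC : p @` (g @` K) = K.
  apply/seteqP; split=> [_ [_ [u Ku <-] <-]|u Ku].
    by have [c [_ Xc cu]] := KX _ Ku; rewrite -cu gp// cu.
  by have [c [_ Xc cu]] := KX _ Ku; exists (g u); [exists u | rewrite -cu gp].
have CD : g @` K `<=` D.
  by move=> _ [u Ku <-]; have [c [Dc Xc <-]] := KX _ Ku; rewrite gp.
have CX : g @` K `<=` X by apply: subset_trans DX.
rewrite -{1}pC; apply: le_trans (le _ cC CX) _; apply: le_measure.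
- rewrite inE; apply: measurable_compact; apply: continuous_compact cC.
  exact: continuous_subspaceT.
- by rewrite inE.
- exact: image_subset.
Qed.

Lemma elementary_invariant_balanced : radon mu ->
  @elementary_invariant R G (phi_of mu) -> totally_balanced mu.
Proof.
move=> hmu ei X bX B mB; have [oX hs hr] := bX.
rewrite gconjE// gconj_src; set D := [set c | _].
have DX : D `<=` X by move=> c [].
have mr : measurable (@rng G @` D).
  by apply: measurable_transport => //; exact: continuous_src.
have ms : measurable (@src G @` D).
  by apply: measurable_transport => //; exact: continuous_src.
have cr := @continuous_rng G; have cs := @continuous_src G.
apply/eqP; rewrite eq_le; apply/andP; split.
  apply: (regular_le hmu bX) => // C cC CX.
  apply: (elementary_compact_le hmu bX) => // f CXf.
  exact: elementary_transfer.
apply: (regular_le hmu bX) => // C cC CX.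
apply: (elementary_compact_le hmu bX) => // f CXf.
exact/esym/elementary_transfer.
Qed.

End Invariance.

Theorem theorem2p5 (R : realType) (G : etale_groupoid)
    (mu : probability (unit_space G) R) (hmu : radon mu) :
  [<-> totally_balanced mu;
       elementary_invariant (phi_of mu);
       fully_invariant (phi_of mu);
       is_tracial_state (@Cred R G) (phi_of mu \o @Ered R G)].
Proof.
have i_iv := @balanced_tracial R G mu hmu.
have iv_iii := @tracial_fully_invariant R G mu.
have iii_ii := @fully_elementary_invariant R G mu.
have ii_i := @elementary_invariant_balanced R G mu hmu.
tfae.
- by move=> /i_iv /iv_iii /iii_ii.
- by move=> /ii_i /i_iv /iv_iii.
- by move=> /iii_ii /ii_i /i_iv.
- by move=> /iv_iii /iii_ii /ii_i.
Qed.
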